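(* Let $k$ be a field of characteristic $0$, $R = k[t_1, \dots, t_n]$, and $x_1, \dots, x_m \in (k^* )^n$. For $1 \le n' \le n$ let $m'_{n'}$ be the maximum of $\operatorname{rank}(\operatorname{Stab}_X(\mathfrak{p}))$ over prime ideals $\mathfrak{p} \subset \mathfrak{m}$ of height $n'$, assume $m'_{n'} < m$ for every $n'$, and set $\eta_{n'} = n'/(m - m'_{n'})$. Let $f \in R$ be nonzero of total degree $D$ and let $N = D^{\eta_1} + D^{\eta_2} + \cdots + D^{\eta_n}$. Then there exists $z \in X(N)$ with $f(z) \neq 0$.
   Context: $X(N) = \{\prod_{i=1}^m x_i^{a_i} : a_i \in \mathbf{Z},\ 0 \le a_i \le N\} \subset (k^* )^n$, products taken coordinatewise; for $a \in \mathbf{Z}^m$ write $x^a = \prod_i x_i^{a_i}$. $\mathfrak{m} = (t_1 - 1, \dots, t_n - 1)$. An element $z \in (k^* )^n$ acts on $R$ by $(z \cdot g)(t) = g(z_1t_1, \dots, z_nt_n)$, and $\operatorname{Stab}_X(\mathfrak{p}) = \{a \in \mathbf{Z}^m : x^a \cdot \mathfrak{p} = \mathfrak{p}\}$. *)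

(* Defs.v *)
From Stdlib Require Import Reals.
From HB Require Import structures.
From mathcomp Require Import all_boot all_order all_algebra.
From mathcomp Require Import mpoly.
Set Implicit Arguments. Unset Strict Implicit. Unset Printing Implicit Defensive.
Import Order.TTheory GRing.Theory Num.Theory.
Local Open Scope ring_scope.

Section Defs.
Variables (k : fieldType) (n m : nat).

Definition pset := {mpoly k[n]} -> Prop.

Definition is_ideal (I : pset) : Prop :=
  I 0 /\ (forall a b, I a -> I b -> I (a + b)) /\ (forall r a, I a -> I (r * a)).

Definition is_prime_ideal (I : pset) : Prop :=
  [/\ is_ideal I, ~ I 1 & forall a b, I (a * b) -> I a \/ I b].

Definition psubset (I J : pset) : Prop := forall g, I g -> J g.
Definition psub_strict (I J : pset) : Prop := psubset I J /\ exists g, J g /\ ~ I g.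
Definition pseteq (I J : pset) : Prop := forall g, I g <-> J g.

Definition has_prime_chain (P : pset) (r : nat) : Prop :=
  exists c : nat -> pset,
    [/\ forall i, (i <= r)%N -> is_prime_ideal (c i),
        forall i, (i < r)%N -> psub_strict (c i) (c i.+1)
      & pseteq (c r) P].

Definition height_eq (P : pset) (h : nat) : Prop :=
  has_prime_chain P h /\ ~ has_prime_chain P h.+1.

Definition mideal : pset :=
  fun g => exists c : 'I_n -> {mpoly k[n]}, g = \sum_(i < n) c i * ('X_i - 1).

Definition zact (z : 'I_n -> k) (g : {mpoly k[n]}) : {mpoly k[n]} :=
  g \mPo [tuple (z i)%:MP * 'X_i | i < n].

Definition xpowz (x : 'I_m -> 'I_n -> k) (a : 'I_m -> int) : 'I_n -> k :=
  fun j => \prod_(i < m) (x i j) ^ (a i).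

Definition fixes_ideal (z : 'I_n -> k) (P : pset) : Prop :=
  forall h, (exists g, P g /\ h = zact z g) <-> P h.

Definition stab (x : 'I_m -> 'I_n -> k) (P : pset) : ('I_m -> int) -> Prop :=
  fun a => fixes_ideal (xpowz x a) P.

Definition rank_ge (S : ('I_m -> int) -> Prop) (r : nat) : Prop :=
  exists v : 'I_r -> 'I_m -> int,
    (forall i, S (v i)) /\ row_free (\matrix_(i < r, j < m) ((v i j)%:~R : rat)).

Definition rank_eq (S : ('I_m -> int) -> Prop) (r : nat) : Prop :=
  rank_ge S r /\ ~ rank_ge S r.+1.

Definition is_max_stab_rank (x : 'I_m -> 'I_n -> k) (n' mp : nat) : Prop :=
  (exists P, [/\ is_prime_ideal P, psubset P mideal, height_eq P n'
                & rank_eq (stab x P) mp]) /\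
  (forall P r, is_prime_ideal P -> psubset P mideal -> height_eq P n' ->
     rank_eq (stab x P) r -> (r <= mp)%N).

Definition xpow (x : 'I_m -> 'I_n -> k) (a : 'I_m -> nat) : 'I_n -> k :=
  fun j => \prod_(i < m) (x i j) ^+ (a i).
End Defs.

Local Close Scope ring_scope.
Local Open Scope R_scope.

(* Real powers D^e for natural D, with the convention 0^e = 0 (used for e > 0) *)
Definition npow (D : nat) (e : R) : R :=
  if D is 0 then 0 else Rpower (INR D) e.

Fixpoint Rsum_1 (g : nat -> R) (n : nat) : R :=
  match n with 0 => 0 | S n' => (Rsum_1 g n' + g (S n')) end.

Definition Xbound (n m : nat) (mp : nat -> nat) (D : nat) : R :=
  Rsum_1 (fun n' => npow D (INR n' / INR (m - mp n'))) n.

(* Main.v *)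
(* If f vanished on X(N), let I_r be the ideal generated by the translates x^a f
   with a_i <= S_1 + ... + S_(r-1), where S_j = floor(D^(eta_j)).  By induction on
   r, every prime containing I_r and contained in the ideal of a point x^b with
   b_i <= S_r + ... + S_n has height at least r; for r = n + 1 and the point 1
   this is absurd.  If the induction broke at r, a prime p of height r would
   contain I_(r+1), so its translates by x^(-a), 0 <= a_i <= S_r, would all be
   isolated primes of I_r; the bound on the rank of the stabilizer of p makes
   more than D^r of them distinct, contradicting Bezout.

   Bezout for isolated primes q_1, ..., q_M of an ideal I generated in degree
   at most D is proved by comparing lengths.  After inverting the polynomials in
   a common transcendence basis of the residue fields, r variables are left and the
   semilocal ring of A/I^(l+1) at q_1, ..., q_M, A being the polynomial ring, is
   spanned by polynomials of degree at most D l + c with c independent of l, because I^l is generated by products of l generators of I.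
   Its length is at least that of the product of the A/q_i^(l+1), i.e. M times
   the number of monomials of degree at most l in r variables, as one sees by
   differentiating.  Letting l tend to infinity gives M <= D^r.

   Heights enter through the number [pdim] of variables in a transcendence basis
   of the residue field: height p = n - pdim p. *)

Require Import Defs.
From Stdlib Require Import Reals Classical ZArith Lra.
From HB Require Import structures.
From mathcomp Require Import all_boot all_order all_algebra.
From mathcomp Require Import ring zify.
From mathcomp Require Import mpoly.
From mathcomp Require boolp classical_sets.
Set Implicit Arguments. Unset Strict Implicit. Unset Printing Implicit Defensive.
Import Order.TTheory GRing.Theory Num.Theory.
Local Open Scope ring_scope.

(** * Ideals and their powers *)

Section Ideals.
Variable R : comNzRingType.
Implicit Types (I P Q G : R -> Prop).

(** The conditions of [is_ideal] over any commutative ring, because primes of iterated polynomial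
    rings also occur; on [{mpoly k[n]}] the two are convertible. *)
Definition ring_ideal I :=
  I 0 /\ (forall a b, I a -> I b -> I (a + b)) /\ (forall r a, I a -> I (r * a)).

Definition ring_prime I :=
  [/\ ring_ideal I, ~ I 1 & forall a b, I (a * b) -> I a \/ I b].

Lemma ring_ideal0 I : ring_ideal I -> I 0. Proof. by case. Qed.

Lemma ring_idealD I a b : ring_ideal I -> I a -> I b -> I (a + b).
Proof. by case=> _ [h _]; apply: h. Qed.

Lemma ring_idealMl I r a : ring_ideal I -> I a -> I (r * a).
Proof. by case=> _ [_ h]; apply: h. Qed.

Lemma ring_idealMr I r a : ring_ideal I -> I a -> I (a * r).
Proof. by rewrite mulrC; apply: ring_idealMl. Qed.

Lemma ring_idealN I a : ring_ideal I -> I a -> I (- a).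
Proof. by rewrite -mulN1r; apply: ring_idealMl. Qed.

Lemma ring_idealB I a b : ring_ideal I -> I a -> I b -> I (a - b).
Proof. by move=> hI ha hb; apply: ring_idealD => //; apply: ring_idealN. Qed.

Lemma ring_idealBK I a b : ring_ideal I -> I (a - b) -> I b -> I a.
Proof. by move=> hI hab hb; rewrite -(subrK b a); apply: ring_idealD. Qed.

Lemma ring_ideal_sum I (T : Type) (r : seq T) (P : pred T) (F : T -> R) :
  ring_ideal I -> (forall i, P i -> I (F i)) -> I (\sum_(i <- r | P i) F i).
Proof.
move=> hI hF; apply: (big_ind I) => //; first exact: ring_ideal0.
by move=> x y; apply: ring_idealD.
Qed.

Lemma prime_ideal P : ring_prime P -> ring_ideal P. Proof. by case. Qed.

Lemma prime_nM P a b : ring_prime P -> ~ P a -> ~ P b -> ~ P (a * b).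
Proof. by case=> _ _ h na nb /h []. Qed.

Lemma prime_nX P a l : ring_prime P -> ~ P a -> ~ P (a ^+ l).
Proof.
move=> hP na; elim: l => [|l IH]; first by rewrite expr0; case: hP.
by rewrite exprS; apply: prime_nM.
Qed.

Lemma prime_nprod P (T : Type) (r : seq T) (C : pred T) (F : T -> R) :
  ring_prime P -> (forall i, C i -> ~ P (F i)) -> ~ P (\prod_(i <- r | C i) F i).
Proof.
move=> hP hF; apply: (big_ind (fun x => ~ P x)) => //; first by case: hP.
by move=> x y; apply: prime_nM.
Qed.

(** An ideal maximal among those that contain [I] and miss the multiplicative set [M] is prime;
    Zorn's lemma provides one. *)
Lemma prime_avoiding I (M : R -> Prop) : ring_ideal I -> M 1 ->
    (forall a b, M a -> M b -> M (a * b)) -> (forall a, I a -> ~ M a) ->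
  exists P, [/\ ring_prime P, forall a, I a -> P a & forall a, P a -> ~ M a].
Proof.
move=> hI M1 MM IM.
pose C (J : R -> Prop) :=
  [/\ forall a b, J a -> J b -> J (a + b), forall r a, J a -> J (r * a)
    & forall a, (J a \/ I a) -> ~ M a].
(* [D A] says that the sum of [I] and [A] with 0 adjoined is an ideal missing [M]; the empty set,
   union of the empty chain, then qualifies. *)
pose D (J : R -> Prop) := C (fun a => exists b c, [/\ J b \/ b = 0, I c & a = b + c]).
have [A [DA maxA]] : exists A, D A /\ forall B,
    classical_sets.proper A B -> ~ D B.
  apply: classical_sets.Zorn_bigcup => F FD Ftot.
  split.
  - move=> _ _ [b [c [hb hc ->]]] [b' [c' [hb' hc' ->]]].
    case: hb => [[X FX Xb]|b0]; last first.
      exists b', (c + c'); split; rewrite ?b0; [by [] | exact: ring_idealD | ring].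
    case: hb' => [[Y FY Yb]|b0]; last first.
      exists b, (c + c'); split; rewrite ?b0; [by left; exists X | exact: ring_idealD | ring].
    have [Z [FZ Zb Zb']] : exists Z, [/\ F Z, Z b & Z b'].
      have [XY|YX] := Ftot _ _ FX FY; first by exists Y; split=> //; apply: XY.
      by exists X; split=> //; apply: YX.
    have [ZD _ _] := FD _ FZ.
    have [||b1 [c1 [hb1 hc1 e1]]] := ZD b b'.
    + by exists b, 0; split; [left | exact: ring_ideal0 | rewrite addr0].
    + by exists b', 0; split; [left | exact: ring_ideal0 | rewrite addr0].
    exists b1, (c1 + (c + c')); split.
    + by case: hb1 => [Zb1|]; [left; exists Z | right].
    + by do 2 apply: ring_idealD => //.
    + by rewrite [RHS]addrA -e1; ring.
  - move=> r _ [b [c [hb hc ->]]].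
    case: hb => [[X FX Xb]|b0]; last first.
      by exists 0, (r * c); split; [right | exact: ring_idealMl | rewrite b0 !add0r].
    have [_ XM _] := FD _ FX.
    have [|b1 [c1 [hb1 hc1 e1]]] := XM r b.
      by exists b, 0; split; [left | exact: ring_ideal0 | rewrite addr0].
    exists b1, (c1 + r * c); split.
    + by case: hb1 => [Xb1|]; [left; exists X | right].
    + by apply: ring_idealD => //; apply: ring_idealMl.
    + by rewrite [RHS]addrA -e1; ring.
  - move=> a [[b [c [hb hc ->]]]|Ia]; last exact: IM.
    case: hb => [[X FX Xb]|b0]; last by rewrite b0 add0r; apply: IM.
    have [_ _ XN] := FD _ FX.
    by apply: XN; left; exists b, c; split=> //; left.
have [PD PM PN] := DA.
set P := fun a => exists b c, [/\ A b \/ b = 0, I c & a = b + c] in PD PM PN.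
have IP a : I a -> P a by move=> Ia; exists 0, a; split; [right | | rewrite add0r].
have AP a : A a -> P a.
  by move=> Aa; exists a, 0; split; [left | exact: ring_ideal0 | rewrite addr0].
have hP : ring_ideal P by split; [apply: IP; exact: ring_ideal0 | split].
exists P; split=> //; last by move=> a Pa; apply: PN; left.
split=> //; first by move=> P1; apply: (PN 1) => //; left.
(* By maximality, adjoining to [P] an element outside it produces an ideal that meets [M]. *)
have grow u : ~ P u -> exists p r, P p /\ M (p + r * u).
  move=> nPu; apply: NNPP => no.
  apply: (maxA (fun a => exists p r, P p /\ a = p + r * u)).
    split; last by move=> /(_ u) nu; apply/nPu/AP/nu; exists 0, 1;
      rewrite add0r mul1r; split=> //; exact: ring_ideal0.
    by move=> a Aa; exists a, 0; rewrite mul0r addr0; split=> //; apply: AP.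
  have norm a : (exists b c, [/\ (exists p r, P p /\ b = p + r * u) \/ b = 0, I c & a = b + c]) ->
      exists p r, P p /\ a = p + r * u.
    move=> [b [c [[[p [r [Pp ->]]]|->] Ic ->]]].
      by exists (p + c), r; split; [apply: ring_idealD => //; exact: IP | ring].
    by exists c, 0; split; [exact: IP | ring].
  have norm' a : (exists p r, P p /\ a = p + r * u) ->
      (exists b c, [/\ (exists p r, P p /\ b = p + r * u) \/ b = 0, I c & a = b + c]).
    by move=> h; exists a, 0; split; [left | exact: ring_ideal0 | rewrite addr0].
  split.
  - move=> a b /norm [p [r [Pp ->]]] /norm [p' [r' [Pp' ->]]]; apply: norm'.
    by exists (p + p'), (r + r'); split; [exact: ring_idealD | ring].
  - move=> s a /norm [p [r [Pp ->]]]; apply: norm'.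
    by exists (s * p), (s * r); split; [exact: ring_idealMl | ring].
  - move=> a [/norm [p [r [Pp ->]]] Mp|Ia]; last exact: IM.
    by apply: no; exists p, r.
move=> a b Pab; apply: NNPP => no.
have [p [r [Pp Mp]]] := grow a (fun h => no (or_introl h)).
have [q [s [Pq Mq]]] := grow b (fun h => no (or_intror h)).
apply: (PN ((p + r * a) * (q + s * b))); last exact: MM.
left.
have -> : (p + r * a) * (q + s * b) = (q + s * b) * p + (r * a) * q + (r * s) * (a * b) by ring.
by apply: (ring_idealD hP); [apply: (ring_idealD hP) |]; apply: (ring_idealMl _ hP).
Qed.

(** The [n]-th power of the ideal generated by [G], the whole ring for [n = 0]. *)
Inductive ipow G : nat -> R -> Prop :=
| ipow_all x : ipow G 0 x
| ipow_zero n : ipow G n 0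
| ipow_gen n f g : G f -> ipow G n g -> ipow G n.+1 (f * g)
| ipow_add n x y : ipow G n x -> ipow G n y -> ipow G n (x + y).

Lemma ipow_ideal G n : ring_ideal (ipow G n).
Proof.
split; first exact: ipow_zero.
split; first exact: ipow_add.
move=> r a h; elim: h r => {n a} [x|n|n f g Gf _ IH|n x y _ IHx _ IHy] r.
- exact: ipow_all.
- by rewrite mulr0; apply: ipow_zero.
- by rewrite mulrCA; apply: ipow_gen.
- by rewrite mulrDr; apply: ipow_add.
Qed.

Lemma ipowM G m n x y : ipow G m x -> ipow G n y -> ipow G (m + n) (x * y).
Proof.
move=> h hy; elim: h => {m x} [x|m|m f g Gf _ IH|m x z _ IHx _ IHz].
- by rewrite add0n; apply: ring_idealMl => //; apply: ipow_ideal.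
- by rewrite mul0r; apply: ipow_zero.
- by rewrite -mulrA addSn; apply: ipow_gen.
- by rewrite mulrDl; apply: ipow_add.
Qed.

Lemma ipowX G n x : ipow G 1 x -> ipow G n (x ^+ n).
Proof.
move=> hx; elim: n => [|n IH]; first exact: ipow_all.
by rewrite exprS -add1n; apply: ipowM.
Qed.

Lemma ipow_incl G Q n x : (forall y, G y -> Q y) -> ipow G n x -> ipow Q n x.
Proof.
move=> GQ; elim=> {n x} [x|n|n f g Gf _ IH|n x y _ IHx _ IHy].
- exact: ipow_all.
- exact: ipow_zero.
- by apply: ipow_gen => //; apply: GQ.
- exact: ipow_add.
Qed.

Lemma ipow_pred G n x : ipow G n.+1 x -> ipow G n x.
Proof.
suff key m : ipow G m x -> forall n, m = n.+1 -> ipow G n x by move=> /key; apply.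
elim=> {m x} [x|m|m f g Gf hg _|m x y _ IHx _ IHy] {}n //.
- by move=> _; apply: ipow_zero.
- by case=> <-; apply: ring_idealMl => //; apply: ipow_ideal.
- by move=> em; apply: ipow_add; [apply: IHx | apply: IHy].
Qed.

Lemma ipow_le G m n x : (m <= n)%N -> ipow G n x -> ipow G m x.
Proof.
move=> /subnK <-; elim: (n - m)%N => [|l IH] //.
by rewrite addSn => /ipow_pred.
Qed.

Lemma ipow1_sub G Q x : ring_ideal Q -> (forall y, G y -> Q y) ->
  ipow G 1 x -> Q x.
Proof.
move=> hQ GQ.
suff key m : ipow G m x -> m = 1%N -> Q x by move=> /key; apply.
elim=> {m x} [x|m|m f g Gf hg _|m x y _ IHx _ IHy] //.
- by move=> _; apply: ring_ideal0.
- by move=> _; apply: ring_idealMr => //; apply: GQ.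
- by move=> em; apply: ring_idealD => //; [apply: IHx | apply: IHy].
Qed.

Lemma ipow1_gen G x : G x -> ipow G 1 x.
Proof. by move=> Gx; rewrite -[x]mulr1; apply: ipow_gen => //; apply: ipow_all. Qed.

(** Otherwise the products [s * g ^+ l] with [s] outside [Q] form a multiplicative set missing the
    ideal of [G], and [prime_avoiding] gives a prime over [G] and below [Q] without [g]. *)
Lemma local_nilpotent G Q g : ring_prime Q ->
    (forall P, ring_prime P -> (forall x, G x -> P x) ->
       (forall x, P x -> Q x) -> P g) ->
  exists s l, ~ Q s /\ ipow G 1 (s * g ^+ l).
Proof.
move=> hQ hmin; apply: NNPP => no.
have [| | | |P [hP GP PM]] := @prime_avoiding (ipow G 1)
    (fun a => exists s l, ~ Q s /\ a = s * g ^+ l).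
- exact: ipow_ideal.
- by exists 1, 0%N; rewrite expr0 mulr1; split=> //; case: hQ.
- move=> _ _ [s [l [ns ->]]] [s' [l' [ns' ->]]].
  exists (s * s'), (l + l')%N; split; first exact: prime_nM.
  by rewrite exprD; ring.
- by move=> a Ia [s [l [ns ea]]]; apply: no; exists s, l; rewrite -ea.
apply: (PM g).
  apply: hmin => // [x Gx|x Px]; first by apply/GP/ipow1_gen.
  by apply: NNPP => nQx; apply: (PM x) => //; exists x, 0%N; rewrite expr0 mulr1.
by exists 1, 1%N; rewrite mul1r expr1; split=> //; case: hQ.
Qed.

End Ideals.

(** * Spanning modulo an ideal *)

(** Padding with zero columns gives a square matrix of determinant 0, which has a left kernel over a
    domain. *)
Lemma left_kernel (B : idomainType) (J K : finType) (a : J -> K -> B) :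
    (#|K| < #|J|)%N ->
  exists v : J -> B, (exists j, v j != 0) /\ forall l, \sum_j v j * a j l = 0.
Proof.
move=> ltKJ.
pose A := \matrix_(i < #|J|, j < #|J|)
  (if insub (j : nat) is Some l then a (enum_val i) (@enum_val K predT l) else 0).
have : \det A == 0.
  rewrite -det_tr; apply/det0P; exists (delta_mx 0 (Ordinal ltKJ)).
    apply/eqP => /matrixP /(_ 0 (Ordinal ltKJ)); by rewrite !mxE !eqxx => /eqP; rewrite oner_eq0.
  apply/rowP => i; rewrite !mxE big1 // => j _; rewrite !mxE.
  have [->|_] := eqVneq j (Ordinal ltKJ); last by rewrite andbF mul0r.
  by rewrite insubN ?mulr0 // ltnn.
case/det0P => v v0 vA.
have [i vi] : exists i, v 0 i != 0.
  apply/existsP; apply: contraR v0; rewrite negb_exists => /forallP h.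
  by apply/eqP/rowP => i; rewrite mxE; apply/eqP; have := h i; rewrite negbK.
exists (fun j => v 0 (enum_rank j)); split; first by exists (enum_val i); rewrite enum_valK.
move=> l; pose i' := widen_ord (ltnW ltKJ) (enum_rank l).
have /matrixP /(_ 0 i') := vA; rewrite !mxE => h; rewrite -[RHS]h.
rewrite (reindex (@enum_rank J)); last by apply: onW_bij; apply: enum_rank_bij.
apply: eq_bigr => j _; rewrite mxE enum_rankK /=.
by rewrite (_ : insub _ = Some (enum_rank l)) ?enum_rankK // valK.
Qed.

Lemma mpolyC_injective (n : nat) (R : nzRingType) : injective (@mpolyC n R).
Proof. by move=> a b /(congr1 (mcoeff 0%MM)); rewrite !mcoeffC eqxx !mulr1. Qed.

Section Spanning.
Variables (B : idomainType) (r : nat).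
Local Notation A := {mpoly B[r]}.
Implicit Types (b : A -> Prop) (x w s : A).

Definition poly_at s (p : {poly B}) : A := (map_poly (@mpolyC r B) p).[s].

Lemma poly_at0 s : poly_at s 0 = 0.
Proof. by rewrite /poly_at rmorph0 horner0. Qed.

Lemma poly_atC s c : poly_at s c%:P = c%:MP.
Proof. by rewrite /poly_at map_polyC hornerC. Qed.

Lemma poly_atD s p q : poly_at s (p + q) = poly_at s p + poly_at s q.
Proof. by rewrite /poly_at rmorphD hornerD. Qed.

Lemma poly_atM s p q : poly_at s (p * q) = poly_at s p * poly_at s q.
Proof. by rewrite /poly_at rmorphM hornerM. Qed.

Lemma poly_atX s : poly_at s 'X = s.
Proof. by rewrite /poly_at map_polyX hornerX. Qed.

Lemma poly_atE s (p : {poly B}) :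
  poly_at s p = \sum_(i < size p) (p`_i)%:MP * s ^+ i.
Proof.
rewrite /poly_at (@horner_coef_wide _ (size p)); last first.
  by rewrite size_map_inj_poly ?rmorph0 //; apply: mpolyC_injective.
by apply: eq_bigr => i _; rewrite coef_map.
Qed.

(** Once the nonzero elements of [B] are inverted, [x] is congruent modulo [b] to a polynomial of
    degree at most [d]; [c] clears denominators. *)
Definition spanned d b x :=
  exists c w, [/\ c != 0, (msize w <= d.+1)%N & b (c%:MP * x - w)].

Lemma spanned_small d b x : ring_ideal b -> (msize x <= d.+1)%N -> spanned d b x.
Proof.
move=> hb hx; exists 1, x; split=> //; first exact: oner_neq0.
by rewrite mpolyC1 mul1r subrr; apply: ring_ideal0.
Qed.

Lemma spanned_add d b x y : ring_ideal b ->
  spanned d b x -> spanned d b y -> spanned d b (x + y).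
Proof.
move=> hb [c [w [c0 sw h]]] [c' [w' [c0' sw' h']]].
exists (c * c'), (c'%:MP * w + c%:MP * w'); split; first by rewrite mulf_neq0.
  apply: leq_trans (msizeD_le _ _) _.
  by rewrite geq_max !mul_mpolyC !(leq_trans (msizeZ_le _ _)).
have -> : (c * c')%:MP * (x + y) - (c'%:MP * w + c%:MP * w') =
   c'%:MP * (c%:MP * x - w) + c%:MP * (c'%:MP * y - w') by rewrite mpolyCM; ring.
by apply: ring_idealD => //; apply: ring_idealMl.
Qed.

Lemma spanned_scale d b a x : ring_ideal b ->
  spanned d b x -> spanned d b (a%:MP * x).
Proof.
move=> hb [c [w [c0 sw h]]]; exists c, (a%:MP * w); split=> //.
  by rewrite mul_mpolyC (leq_trans (msizeZ_le _ _)).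
have -> : c%:MP * (a%:MP * x) - a%:MP * w = a%:MP * (c%:MP * x - w) by ring.
exact: ring_idealMl.
Qed.

Lemma spanned_sum d b (T : Type) (s : seq T) (P : pred T) (F : T -> A) :
  ring_ideal b -> (forall i, P i -> spanned d b (F i)) ->
  spanned d b (\sum_(i <- s | P i) F i).
Proof.
move=> hb hF; apply: (big_ind (spanned d b)) => // [|x y].
  by apply: spanned_small; rewrite ?msize0.
exact: spanned_add.
Qed.

Lemma spanned_div d b a x : ring_ideal b -> a != 0 ->
  spanned d b (a%:MP * x) -> spanned d b x.
Proof.
move=> hb a0 [c [w [c0 sw h]]]; exists (c * a), w; split=> //.
  by rewrite mulf_neq0.
by rewrite mpolyCM -mulrA.
Qed.

Lemma spanned_congr d b x y : ring_ideal b -> b (x - y) ->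
  spanned d b y -> spanned d b x.
Proof.
move=> hb hxy [c [w [c0 sw h]]]; exists c, w; split=> //.
have -> : c%:MP * x - w = c%:MP * (x - y) + (c%:MP * y - w) by ring.
by apply: ring_idealD => //; apply: ring_idealMl.
Qed.

(** A monomial of degree above the sum of the degrees of the [p v] has, for some [v], exponent at
    least the degree of [p v]; that relation then lowers its total degree. *)
Lemma algebraic_spanned b : ring_ideal b ->
    (forall v, exists p, p != 0 /\ b (poly_at 'X_v p)) ->
  exists d, forall x, spanned d b x.
Proof.
move=> hb /fin_all_exists [p hp].
pose d := (\sum_v (size (p v)).-1)%N; exists d.
suff mon m : spanned d b 'X_[m].
  move=> x; rewrite [x]mpolyE; apply: spanned_sum => // m _.
  by rewrite -mul_mpolyC; apply: spanned_scale.
have [N] := ubnP (mdeg m); elim: N m => // N IH m; rewrite ltnS => mN.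
have [md|dm] := leqP (mdeg m) d.
  by apply: spanned_small => //; rewrite msizeX ltnS.
have [v hv] : exists v, ((size (p v)).-1 <= m v)%N.
  apply/existsP; move: dm; apply: contraLR; rewrite negb_exists => /forallP h.
  rewrite -leqNgt mdegE; apply: leq_sum => v _.
  by apply: ltnW; rewrite ltnNge.
have [p0 bp] := hp v.
have sp : (0 < size (p v))%N by rewrite size_poly_gt0.
set e := (size (p v)).-1 in hv.
have ee : size (p v) = e.+1 by rewrite /e prednK.
pose m' := (m - U_(v) *+ e)%MM.
have em : m = (m' + U_(v) *+ e)%MM.
  apply/mnmP => i; rewrite mnmDE mnmBE !mulmnE mnm1E; have [<-|_] := eqVneq v i.
    by rewrite mul1n subnK.
  by rewrite mul0n subn0 addn0.
apply: (@spanned_div _ _ (lead_coef (p v))) => //; first by rewrite lead_coef_eq0.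
have key : (lead_coef (p v))%:MP * 'X_[m] =
    'X_[m'] * poly_at 'X_v (p v) - \sum_(i < e) ((p v)`_i)%:MP * 'X_[(m' + U_(v) *+ i)%MM].
  rewrite poly_atE ee big_ord_recr /= mulrDr mulr_sumr.
  rewrite [X in _ = X - _]addrC -addrA.
  rewrite (eq_bigr (fun i : 'I_e => ((p v)`_i)%:MP * 'X_[(m' + U_(v) *+ i)%MM])) ?subrr ?addr0; last first.
    by move=> i _; rewrite mpolyXD mpolyXn; ring.
  by rewrite /lead_coef ee /= {1}em mpolyXD mpolyXn; ring.
rewrite key; apply: (@spanned_congr _ _ _ (- \sum_(i < e) ((p v)`_i)%:MP * 'X_[(m' + U_(v) *+ i)%MM])) => //.
  by rewrite opprK addrNK; apply: ring_idealMl.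
rewrite -sumrN; apply: spanned_sum => // i _; rewrite -mulNr -mpolyCN.
apply: spanned_scale => //; apply: IH.
have dm' : mdeg m = (mdeg m' + e)%N by rewrite {1}em mdegD mdegMn mdeg1 mul1n.
by rewrite mdegD mdegMn mdeg1 mul1n; have := ltn_ord i; lia.
Qed.

Lemma dependent_mod b d (J : finType) (x : J -> A) : ring_ideal b ->
    (forall j, spanned d b (x j)) -> (#|{: 'X_{1..r < d.+1}}| < #|J|)%N ->
  exists v : J -> B, (exists j, v j != 0) /\ b (\sum_j (v j)%:MP * x j).
Proof.
move=> hb /fin_all_exists [c /fin_all_exists [w hw]] ltJ.
have [v [[j vj] hv]] := left_kernel (fun j (m : 'X_{1..r < d.+1}) => (w j)@_m) ltJ.
exists (fun j => v j * c j); split.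
  by exists j; case: (hw j) => cj _ _; rewrite mulf_neq0.
have sum0 : \sum_j (v j)%:MP * w j = 0.
  apply/mpolyP => m; rewrite mcoeff0 raddf_sum /=.
  have [md|dm] := ltnP (mdeg m) d.+1.
    by rewrite -[RHS](hv (BMultinom md)); apply: eq_bigr => i _; rewrite mcoeffCM.
  rewrite big1 // => i _; rewrite mcoeffCM memN_msupp_eq0 ?mulr0 //.
  by apply: msize_mdeg_ge; apply: leq_trans dm; case: (hw i).
have -> : \sum_j (v j * c j)%:MP * x j = \sum_j (v j)%:MP * ((c j)%:MP * x j - w j).
  rewrite -[LHS]subr0 -[X in _ - X]sum0 -sumrB; apply: eq_bigr => i _.
  by rewrite mpolyCM; ring.
by apply: ring_ideal_sum => // i _; apply: ring_idealMl => //; case: (hw i).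
Qed.

(** The powers of [s] satisfy a polynomial relation over [B] modulo [b]. As [s] is not a zero
    divisor modulo [b], factors [s] can be cancelled until the constant term is nonzero. *)
Lemma inverse_mod b d s : ring_ideal b -> (forall x, spanned d b x) ->
    (forall g, b (s * g) -> b g) ->
  exists c t, c != 0 /\ b (s * t + c%:MP).
Proof.
move=> hb span sat.
pose N := #|{: 'X_{1..r < d.+1}}|.
have [|v [[j vj] hv]] := @dependent_mod b d 'I_N.+1 (fun i => s ^+ i) hb (fun i => span _).
  by rewrite card_ord.
pose p := \poly_(i < N.+1) v (inord i).
have : b (poly_at s p).
  rewrite /poly_at (@horner_coef_wide _ N.+1); last first.
    rewrite size_map_inj_poly ?rmorph0 ?size_poly //; exact: mpolyC_injective.
  by congr b: hv; apply: eq_bigr => i _; rewrite coef_map coef_poly ltn_ord inord_val.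
have : p != 0.
  apply: contra vj => /eqP p0; have := coef_poly N.+1 (fun i => v (inord i)) j.
  by rewrite -/p p0 coef0 ltn_ord inord_val => <-.
elim/poly_ind: p => [|p c IH]; first by rewrite eqxx.
move=> pc0; rewrite poly_atD poly_atM poly_atX poly_atC => bpc.
have [c0|c0] := eqVneq c 0.
  apply: IH; first by apply: contra_neq pc0 => ->; rewrite c0 mul0r addr0.
  by apply: sat; move: bpc; rewrite c0 addr0 mulrC.
by exists c, (poly_at s p); split=> //; rewrite mulrC.
Qed.

End Spanning.

(** * Independence in the associated graded ring *)

Section GradedIndependence.
Variables (B : idomainType) (r : nat).
Local Notation A := {mpoly B[r]}.
Variables (Q : A -> Prop) (h : 'I_r -> A).
Hypothesis primeQ : ring_prime Q.
Hypothesis charQ : forall x n, Q (x *+ n.+1) -> Q x.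
Hypothesis Qh : forall v, Q (h v).
Hypothesis dh0 : forall v w, w != v -> (h v)^`M(w) = 0.
Hypothesis dh : forall v, ~ Q (h v)^`M(v).

Lemma ipow_mderiv v n x : ipow Q n x -> ipow Q n.-1 x^`M(v).
Proof.
elim=> {n x} [x|n|n f g Qf hg IH|n x y _ IHx _ IHy] /=.
- exact: ipow_all.
- by rewrite mderiv0; apply: ipow_zero.
- rewrite mderivM; apply: ipow_add; first by apply: ring_idealMl => //; apply: ipow_ideal.
  by case: n IH {hg} => [|n] IH; [apply: ipow_all | apply: ipow_gen].
- by rewrite mderivD; apply: ipow_add.
Qed.

Lemma ipow_prodX (m : 'X_{1..r}) : ipow Q (mdeg m) (\prod_i h i ^+ m i).
Proof.
rewrite mdegE; apply: (big_ind2 (fun d x => ipow Q d x)); first exact: ipow_all.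
  by move=> ? ? ? ?; apply: ipowM.
by move=> i _; apply/ipowX/ipow1_gen.
Qed.

Lemma ipow_meval nu (F : {mpoly A[r]}) :
  (forall m, (mdeg m < nu)%N -> F@_m = 0) -> ipow Q nu F.@[h].
Proof.
move=> hF; rewrite mevalE; apply: ring_ideal_sum => [|m _]; first exact: ipow_ideal.
have [lt|ge] := ltnP (mdeg m) nu; first by rewrite hF // mul0r; apply: ipow_zero.
by apply: ring_idealMl; [apply: ipow_ideal | apply: ipow_le ge _; apply: ipow_prodX].
Qed.

Lemma mderiv_prodX v (m : 'X_{1..r}) : (\prod_i h i ^+ m i)^`M(v) =
  (\prod_i h i ^+ (m - U_(v))%MM i) * (h v)^`M(v) *+ m v.
Proof.
have dX x l : (x ^+ l)^`M(v) = x ^+ l.-1 * x^`M(v) *+ l :> A.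
  elim: l => [|l IH]; first by rewrite expr0 mulr0n -mpolyC1 mderivC.
  rewrite exprS mderivM IH /=; case: l {IH} => [|l]; first by rewrite !expr0 mulr0n; ring.
  by rewrite !mulrS exprS; ring.
have d0 (P : pred 'I_r) : P =1 predC1 v -> (\prod_(i | P i) h i ^+ m i)^`M(v) = 0.
  move=> eP; apply: (big_ind (fun x : A => x^`M(v) = 0)).
  - by rewrite -mpolyC1 mderivC.
  - by move=> x y hx hy; rewrite mderivM hx hy mul0r mulr0 addr0.
  - by move=> i; rewrite eP /= => iv; rewrite dX dh0 1?eq_sym // mulr0 mul0rn.
rewrite (bigD1 v) //= mderivM d0 // mulr0 addr0 dX [in RHS](bigD1 v) //=.
rewrite mnmBE mnm1E eqxx subn1 -!mulrnAr -!mulrA; congr (_ * _).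
rewrite mulrC; congr (_ * _); apply: eq_bigr => i iv.
by rewrite mnmBE mnm1E eq_sym (negPf iv) subn0.
Qed.

(** Chain rule: among the [h w] only [h v] has a nonzero derivative along [v]; [G] collects the
    derivatives of the coefficients. *)
Lemma mderiv_meval v (F : {mpoly A[r]}) : exists G : {mpoly A[r]},
  (forall m, G@_m = (F@_m)^`M(v)) /\
  F.@[h]^`M(v) = G.@[h] + (h v)^`M(v) * F^`M(v).@[h].
Proof.
elim/mpolyind: F => [|c m F _ _ [G [cG eG]]].
  exists 0; split; first by move=> m; rewrite !mcoeff0 mderiv0.
  by rewrite mderiv0 !meval0 mderiv0 mulr0 addr0.
exists (c^`M(v) *: 'X_[m] + G); split.
  move=> m'; rewrite !mcoeffD !mcoeffZ mderivD cG !mcoeffX; congr (_ + _).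
  by case: eqP => _; rewrite ?mulr1 // !mulr0 mderiv0.
rewrite !mevalD mderivD eG mderivD mevalD !mderivZ !mevalZ mderivX mevalZ !mevalX.
rewrite mderivM mderiv_prodX mulr_natl mulrDr !mulrnAr addrACA.
congr (_ + (_ *+ _ + _)); by rewrite mulrA mulrC.
Qed.

(** Monomials of degree [nu] in the [h v] are independent over A/Q in Q^nu/Q^(nu+1). Differentiating
    along [v] lowers both the power of [Q] and the degree by one, at the price of the derivative of
    [h v], which is outside [Q], and of an exponent, which [charQ] removes. *)
Lemma gr_independent nu (F : {mpoly A[r]}) :
    (forall m, (mdeg m < nu)%N -> F@_m = 0) -> ipow Q nu.+1 F.@[h] ->
  forall m, mdeg m = nu -> Q F@_m.
Proof.
have idQ := prime_ideal primeQ.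
elim: nu F => [|nu IH] F F0 QF m em.
  move/eqP: em; rewrite mdeg_eq0 => /eqP ->.
  have : ipow Q 1 (F - (F@_0)%:MP).@[h].
    apply: ipow_meval => m'; rewrite ltnS leqn0 mdeg_eq0 => /eqP ->.
    by rewrite mcoeffB mcoeffC eqxx mulr1 subrr.
  rewrite mevalB mevalC => /(ipow1_sub idQ (fun y Qy => Qy)) Q1.
  move/(ipow1_sub idQ (fun y Qy => Qy)): QF => Q2.
  have -> : F@_0 = F.@[h] - (F.@[h] - F@_0) by ring.
  exact: ring_idealB.
have [v mv] : exists v, (0 < m v)%N.
  apply/existsP; have : mdeg m != 0%N by rewrite em.
  apply: contraR; rewrite negb_exists => /forallP m0.
  by rewrite mdegE big1 // => i _; apply/eqP; have := m0 i; rewrite lt0n negbK.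
pose m' := (m - U_(v))%MM.
have mE : m = (m' + U_(v))%MM.
  apply/mnmP => i; rewrite mnmDE mnmBE mnm1E; have [<-|_] := eqVneq v i.
    by rewrite subnK.
  by rewrite subn0 addn0.
have [G [cG eG]] := mderiv_meval v F.
have Qm : Q ((h v)^`M(v)%:MP * F^`M(v))@_m'.
  apply: IH.
  - by move=> m1 lt1; rewrite mcoeffCM mcoeff_deriv F0 ?mul0rn ?mulr0 // mdegD mdeg1; lia.
  - rewrite mevalM mevalC.
    have -> : (h v)^`M(v) * F^`M(v).@[h] = F.@[h]^`M(v) - G.@[h] by rewrite eG; ring.
    apply: ring_idealB; [exact: ipow_ideal | exact: ipow_mderiv QF |].
    by apply: ipow_meval => m1 lt1; rewrite cG F0 // mderiv0.
  - by apply/eqP; rewrite -(eqn_add2r 1) -{1}(mdeg1 v) -mdegD -mE em addn1.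
rewrite mcoeffCM mcoeff_deriv -mE in Qm.
apply: (@charQ _ (m' v)); case: primeQ => _ _ /(_ _ _ Qm) [] //.
by move/dh.
Qed.

End GradedIndependence.

(** * Counting monomials *)

(** Euclidean division of the exponents by [D] leaves [r] remainders below [D] and a quotient of
    degree at most [d + c]. *)
Lemma card_bmultinom_scale r D d c : (0 < D)%N ->
  (#|{: 'X_{1..r < (D * d + c).+1}}| <= D ^ r * #|{: 'X_{1..r < (d + c).+1}}|)%N.
Proof.
move=> D0.
have mod_lt a : (a %% D < D)%N by rewrite ltn_mod.
have div_lt (m : 'X_{1..r < (D * d + c).+1}) :
    (mdeg [multinom (m i %/ D)%N | i < r] < (d + c).+1)%N.
  have : (D * mdeg [multinom (m i %/ D)%N | i < r] <= mdeg m)%N.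
    rewrite !mdegE big_distrr /=; apply: leq_sum => i _.
    by rewrite mnmE mulnC leq_trunc_div.
  have := bmdeg m; rewrite !ltnS => h1 h2.
  have : (D * mdeg [multinom (m i %/ D)%N | i < r] <= D * (d + c))%N.
    by apply: leq_trans h2 (leq_trans h1 _); rewrite mulnDr leq_add2l leq_pmull.
  by rewrite leq_pmul2l.
pose phi (m : 'X_{1..r < (D * d + c).+1}) :
    {ffun 'I_r -> 'I_D} * 'X_{1..r < (d + c).+1} :=
  ([ffun i => Ordinal (mod_lt (m i))], BMultinom (div_lt m)).
have /leq_card : injective phi.
  move=> m m' e; apply/val_inj/mnmP => i /=.
  have /ffunP /(_ i) := congr1 fst e.
  have /(congr1 (fun M : 'X_{1..r} => M i)) := congr1 (@bmnm _ _ \o snd) e.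
  rewrite /= !ffunE !mnmE => e3 /(congr1 val) /= e4.
  by rewrite (divn_eq (m i) D) e3 e4 -divn_eq.
by rewrite card_prod card_ffun !card_ord.
Qed.

Lemma card_bmultinom_le r d : (#|{: 'X_{1..r < d.+1}}| <= d.+1 ^ r)%N.
Proof.
have lt (m : 'X_{1..r < d.+1}) i : (m i < d.+1)%N.
  by apply: leq_ltn_trans (bmdeg m); rewrite mdegE (bigD1 i) //= leq_addr.
pose phi (m : 'X_{1..r < d.+1}) := [ffun i => Ordinal (lt m i)].
have /leq_card : injective phi.
  move=> m m' /ffunP e; apply/val_inj/mnmP => i /=.
  by have := e i; rewrite !ffunE => /(congr1 val).
by rewrite card_ffun !card_ord.
Qed.

Lemma exp_beats_poly a r : exists L, ((a * L).+1 ^ r < 2 ^ L)%N.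
Proof.
(* [u] is chosen so that (a + 2u) r < (u + 1)^2 <= 2^(2u). *)
pose u := (2 * r + r * a.+1)%N; exists (2 ^ (2 * u))%N.
have le1 : ((a * 2 ^ (2 * u)).+1 <= 2 ^ (a + 2 * u))%N.
  rewrite expnD; apply: (@leq_trans (a.+1 * 2 ^ (2 * u))).
    by rewrite mulSn -add1n leq_add2r expn_gt0.
  by rewrite leq_mul2r orbC ltn_expl.
apply: (@leq_ltn_trans ((2 ^ (a + 2 * u)) ^ r)); first by case: (r) => [|r0]; rewrite ?expn0 // leq_exp2r.
rewrite -expnM ltn_exp2l //.
have hu : (u < 2 ^ u)%N by rewrite ltn_expl.
have -> : (2 ^ (2 * u) = 2 ^ u * 2 ^ u)%N by rewrite mul2n -addnn expnD.
apply: (@leq_trans (u.+1 * u.+1)); last exact: leq_mul.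
by rewrite /u; nia.
Qed.

(** If [N > K], iterating the inequality from [d = 0] in steps of [c] bounds (K+1)^j by K^j times a
    quantity polynomial in [j], which fails for large [j]. *)
Lemma asymptotic_ratio N K c r : (0 < K)%N ->
    (forall d, N * #|{: 'X_{1..r < d.+1}}| <= K * #|{: 'X_{1..r < (d + c).+1}}|)%N ->
  (N <= K)%N.
Proof.
move=> K0 h; rewrite leqNgt; apply/negP => KN.
have step j : (K.+1 ^ j <= K ^ j * #|{: 'X_{1..r < (j * c).+1}}|)%N.
  elim: j => [|j IH].
    rewrite !expn0 mul1n; apply/card_gt0P.
    have h0 : (mdeg (0%MM : 'X_{1..r}) < (0 * c).+1)%N by rewrite mdeg0.
    by exists (BMultinom h0).
  rewrite expnS; apply: (@leq_trans (K.+1 * (K ^ j * #|{: 'X_{1..r < (j * c).+1}}|))).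
    by rewrite leq_mul2l IH orbT.
  rewrite expnSr mulnCA -mulnA leq_mul2l; apply/orP; right.
  rewrite [(j.+1 * c)%N]mulSnr.
  apply: leq_trans (h _); by rewrite leq_mul2r KN orbT.
(* The first two terms of the binomial expansion of (K+1)^K both equal K^K. *)
have dbl : (2 * K ^ K <= K.+1 ^ K)%N.
  rewrite -[K.+1]addn1 expnDn.
  case: K K0 {h KN step} => // K _.
  by rewrite !big_ord_recl /= /bump /= !subn0 !bin0 !exp1n bin1 subn1 /=
    !mul1n !muln1 -expnS addnA mul2n -addnn leq_addr.
have [L hL] := exp_beats_poly (K * c) r.
have := step (K * L)%N; apply/negP; rewrite -ltnNge.
apply: (@leq_trans (2 ^ L * K ^ (K * L))); last first.
  by rewrite !expnM -expnMn; case: (L) => [|l]; rewrite ?expn0 // leq_exp2r.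
rewrite mulnC ltn_pmul2r ?expn_gt0 ?K0 //.
apply: leq_ltn_trans (card_bmultinom_le _ _) _.
by rewrite mulnAC.
Qed.

(** * Bezout for isolated primes *)

Lemma mderiv_poly_at (B : idomainType) r (v w : 'I_r) (p : {poly B}) :
  (poly_at 'X_v p)^`M(w) = if w == v then poly_at 'X_v p^`() else 0.
Proof.
elim/poly_ind: p => [|p c IH]; first by rewrite deriv0 poly_at0 mderiv0 if_same.
rewrite poly_atD poly_atM poly_atX poly_atC mderivD mderivM mderivC addr0 IH.
rewrite mderivX mnm1E derivD derivM derivX derivC mulr1 addr0 poly_atD poly_atM poly_atX.
have [->|_] := eqVneq v w; last by rewrite scale0r mul0r mulr0 addr0.
by rewrite scale1r (_ : (U_(w) - U_(w))%MM = 0%MM) ?mpolyX0 ?mulr1 //;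
  apply/mnmP => i; rewrite mnmBE subnn mnm0E.
Qed.

Section IsolatedPrimes.
Variables (B : idomainType) (r : nat).
Hypothesis charB : forall n, n.+1%:R != 0 :> B.
Local Notation A := {mpoly B[r]}.
Variables (I : finType) (q : I -> A -> Prop) (G : A -> Prop) (D : nat).
(** In the application [B] is the polynomial ring in a common transcendence basis of the residue
    fields: its nonzero elements are invertible at every [q i] by [qB], and the other variables are
    algebraic over it by [qalg]. [qrad] expresses that the [q i] are isolated over [G]. *)
Hypothesis primeq : forall i, ring_prime (q i).
Hypothesis qB : forall i c, q i c%:MP -> c = 0.
Hypothesis qalg : forall i v, exists p, p != 0 /\ q i (poly_at 'X_v p).
Hypothesis Gdeg : forall f, G f -> (msize f <= D.+1)%N.
Hypothesis Gq : forall i f, G f -> q i f.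
Hypothesis qsep : forall i j, i != j -> exists g, q i g /\ ~ q j g.
Hypothesis qrad : forall i g, q i g -> exists s l, ~ q i s /\ ipow G 1 (s * g ^+ l).

Let idealq i := prime_ideal (primeq i).

Definition outside s := forall i, ~ q i s.

(* The n-th power of the ideal generated by [G], localized at the primes [q i]. *)
Definition local_power n g := exists s, outside s /\ ipow G n (s * g).

Lemma outsideM s t : outside s -> outside t -> outside (s * t).
Proof. by move=> hs ht i; apply: prime_nM. Qed.

Lemma outside1 : outside 1. Proof. by move=> i; case: (primeq i). Qed.

Lemma local_powerW n g : ipow G n g -> local_power n g.
Proof. by exists 1; rewrite mul1r; split=> //; apply: outside1. Qed.

Lemma local_powerM m n x y :
  local_power m x -> local_power n y -> local_power (m + n) (x * y).
Proof.
move=> [s [os hs]] [t [ot ht]]; exists (s * t); split; first exact: outsideM.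
by rewrite mulrACA; apply: ipowM.
Qed.

Lemma local_power_ideal n : ring_ideal (local_power n).
Proof.
split; first by apply/local_powerW/ipow_zero.
split.
  move=> a b [s [os hs]] [t [ot ht]]; exists (s * t); split; first exact: outsideM.
  have -> : s * t * (a + b) = t * (s * a) + s * (t * b) by ring.
  by apply: ipow_add; apply: ring_idealMl => //; apply: ipow_ideal.
move=> x a ha; rewrite -[n]add0n; apply: local_powerM => //.
by apply/local_powerW/ipow_all.
Qed.

Lemma local_power_sat n s g : outside s -> local_power n (s * g) -> local_power n g.
Proof.
move=> os [t [ot ht]]; exists (t * s); split; first exact: outsideM.
by rewrite -mulrA.
Qed.

(** The product over the [j] other than [i] of elements of [q j] outside [q i] stays outside [q i]
    by primality. *)
Lemma separating_elements :
  exists u : I -> A, forall i, ~ q i (u i) /\ forall j, j != i -> q j (u i).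
Proof.
have /fin_all_exists [g hg] (i : I) :
    exists g : I -> A, forall j, j != i -> q j (g j) /\ ~ q i (g j).
  apply: (@fin_all_exists _ _ (fun j gj => j != i -> q j gj /\ ~ q i gj)) => j.
  have [->|ji] := eqVneq j i; first by exists 0.
  by have [x hx] := qsep ji; exists x.
exists (fun i => \prod_(j | j != i) g i j) => i; split.
  by apply: prime_nprod => // j ji; case: (hg i j ji).
move=> j ji; rewrite (bigD1 j) //=; apply: ring_idealMr => //.
by case: (hg i j ji).
Qed.

(** In the sum of the [s i * u i], with [u] separating, exactly one term lies outside a given prime,
    so the sum lies outside all of them. *)
Lemma outside_glue (J : A -> Prop) g : ring_ideal J ->
    (forall i, exists s, ~ q i s /\ J (s * g)) ->
  exists s, outside s /\ J (s * g).
Proof.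
move=> hJ /fin_all_exists [s hs]; have [u hu] := separating_elements.
exists (\sum_i s i * u i); split.
  move=> i; rewrite (bigD1 i) //= => h.
  have : q i (s i * u i).
    rewrite -[_ * _](addrK (\sum_(j | j != i) s j * u j)).
    apply: ring_idealB => //; apply: ring_ideal_sum => // j ji.
    by apply: ring_idealMl => //; case: (hu j) => _; apply; rewrite eq_sym.
  by apply: prime_nM => //; [case: (hs i) | case: (hu i)].
rewrite mulr_suml; apply: ring_ideal_sum => // i _.
by rewrite mulrAC; apply: ring_idealMr => //; case: (hs i).
Qed.

(** The product of the relations at the single primes lies in all of them, so by [qrad] a power of
    it lies locally in the ideal of [G]. *)
Lemma local_algebraic v : exists p, p != 0 /\ local_power 1 (poly_at 'X_v p).
Proof.
have /fin_all_exists [p hp] : forall i, exists p, p != 0 /\ q i (poly_at 'X_v p).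
  by move=> i; apply: qalg.
pose P := \prod_i p i.
have P0 : P != 0 by apply/prodf_neq0 => i _; case: (hp i).
have qP i : q i (poly_at 'X_v P).
  by rewrite /P (bigD1 i) //= poly_atM; apply: ring_idealMr => //; case: (hp i).
have /fin_all_exists [s /fin_all_exists [l hl]] i := qrad (qP i).
pose L := (\sum_i l i)%N; exists (P ^+ L); split; first exact: expf_neq0.
have -> : poly_at 'X_v (P ^+ L) = poly_at 'X_v P ^+ L.
  by elim: (L) => [|j IH]; rewrite ?expr0 ?poly_atC // !exprS poly_atM IH.
apply: outside_glue; first exact: ipow_ideal.
move=> i; exists (s i); case: (hl i) => ns hi; split=> //.
have -> : L = (l i + \sum_(j | j != i) l j)%N by rewrite /L (bigD1 i).
by rewrite exprD mulrA; apply: ring_idealMr => //; apply: ipow_ideal.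
Qed.

Lemma outside_inverse d s : (forall x, spanned d (local_power 1) x) -> outside s ->
  exists c t, c != 0 /\ local_power 1 (s * t + c%:MP).
Proof.
move=> span os; apply: (inverse_mod _ span); first exact: local_power_ideal.
by move=> g; apply: local_power_sat.
Qed.

(** Only the cofactor of the [n] generators is reduced, so [d] is paid once while each generator
    adds [D]. *)
Lemma ipow_spanned d n x : (forall x, spanned d (local_power 1) x) ->
  ipow G n x -> spanned (D * n + d) (local_power n.+1) x.
Proof.
move=> span; elim=> {n x} [x|n|n f g Gf _ [c [w [c0 sw h]]]|n x y _ IHx _ IHy].
- by rewrite muln0 add0n; apply: span.
- by apply: spanned_small; [apply: local_power_ideal | rewrite msize0].
- exists c, (f * w); split=> //.
    have [->|f0] := eqVneq f 0; first by rewrite mul0r msize0.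
    have [->|w0] := eqVneq w 0; first by rewrite mulr0 msize0.
    rewrite msizeM //; have := Gdeg Gf; move: (msize f) (msize w) sw => a b; nia.
  have -> : c%:MP * (f * g) - f * w = f * (c%:MP * g - w) by ring.
  rewrite -[n.+2]add1n; apply: local_powerM => //.
  by apply/local_powerW/ipow1_gen.
- by apply: spanned_add => //; apply: local_power_ideal.
Qed.

(** Induction on the power: the remainder [a] has [s * a] in the actual power for some [s] outside
    all [q i]. As [s] is invertible modulo the ideal up to a constant, [a] can be replaced by a
    multiple of [s * a], to which [ipow_spanned] applies. *)
Lemma all_spanned d n x : (forall x, spanned d (local_power 1) x) ->
  spanned (D * n + d) (local_power n.+1) x.
Proof.
move=> span; elim: n x => [|n IH] x; first by rewrite muln0 add0n; apply: span.
have id2 := local_power_ideal n.+2.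
have [c [w [c0 sw ha]]] := IH x.
apply: (@spanned_div _ _ _ _ c) => //; rewrite -(subrK w (c%:MP * x)).
apply: spanned_add => //; last first.
  by apply: spanned_small => //; apply: leq_trans sw _; rewrite ltnS; nia.
move: (c%:MP * x - w) ha => a ha.
case: (ha) => s [os hs].
have [c1 [t [c10 ht]]] := outside_inverse span os.
apply: (@spanned_div _ _ _ _ c1) => //.
apply: (@spanned_congr _ _ _ _ _ (- t * (s * a))) => //.
  have -> : c1%:MP * a - - t * (s * a) = (s * t + c1%:MP) * a by ring.
  by rewrite -[n.+2]add1n; apply: local_powerM.
by apply: ipow_spanned => //; apply: ring_idealMl => //; apply: ipow_ideal.
Qed.

(** A relation for ['X_v] is differentiated as long as the result stays in [q i]. By [qB] and
    characteristic 0 it never becomes constant or zero there, so the descent stops at a polynomial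
    in ['X_v] alone whose derivative is outside [q i]. *)
Lemma uniformizers i : exists h : 'I_r -> A, forall v, [/\ q i (h v),
  forall w, w != v -> (h v)^`M(w) = 0 & ~ q i (h v)^`M(v)].
Proof.
apply: (@fin_all_exists _ _ (fun v hv => [/\ q i hv,
  forall w, w != v -> hv^`M(w) = 0 & ~ q i hv^`M(v)])) => v.
have [p [p0 qp]] := qalg i v.
have [N] := ubnP (size p); elim: N p p0 qp => // N IH p p0 qp; rewrite ltnS => sN.
have sp : (1 < size p)%N.
  rewrite ltnNge; apply/negP => /size1_polyC pC.
  by move: qp p0; rewrite pC poly_atC => /qB ->; rewrite eqxx.
have p'0 : p^`() != 0.
  apply: contraTneq sp => d0; rewrite -leqNgt.
  rewrite leqNgt; apply/negP => sp; have := coef_deriv p (size p).-2.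
  rewrite d0 coef0 => /esym /eqP; rewrite -mulr_natr mulf_eq0.
  rewrite (negPf (charB _)) orbF (_ : (size p).-2.+1 = (size p).-1); last by lia.
  by rewrite -/(lead_coef p) lead_coef_eq0 (negPf p0).
have [qp'|nqp'] := classic (q i (poly_at 'X_v p^`())).
  by apply: (IH p^`()) => //; apply: leq_trans (lt_size_deriv p0) _.
exists (poly_at 'X_v p); split=> //; last by rewrite mderiv_poly_at eqxx.
by move=> w wv; rewrite mderiv_poly_at (negPf wv).
Qed.

(** A high power of a separating element stays outside [q i] and, by [qrad], falls into the [n]-th
    power of the ideal at every other [q j]. *)
Lemma local_idempotents n : exists e : I -> A, forall i, ~ q i (e i) /\
  forall j, j != i -> exists s, ~ q j s /\ ipow G n (s * e i).
Proof.
have [u hu] := separating_elements.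
apply: (@fin_all_exists _ _ (fun i ei => ~ q i ei /\
  forall j, j != i -> exists s, ~ q j s /\ ipow G n (s * ei))) => i.
have [ni qi] := hu i.
have /fin_all_exists [l hl] (j : I) :
    exists l, j != i -> exists s, ~ q j s /\ ipow G 1 (s * u i ^+ l).
  have [->|ji] := eqVneq j i; first by exists 0%N.
  by have [s [l h]] := qrad (qi j ji); exists l => _; exists s.
exists ((u i ^+ (\sum_j l j)) ^+ n); split; first by do 2 apply: prime_nX => //.
move=> j ji; have [s [ns hs]] := hl j ji; exists (s ^+ n); split; first exact: prime_nX.
rewrite -exprMn; apply: ipowX; rewrite (bigD1 j) //= exprD mulrA.
by apply: ring_idealMr => //; apply: ipow_ideal.
Qed.

Lemma charq i x n : q i (x *+ n.+1) -> q i x.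
Proof.
have -> : x *+ n.+1 = (n.+1%:R)%:MP * x :> A.
  by rewrite mpolyCMn mpolyC1 mulr_natl.
case: (primeq i) => _ _ h /h [/qB/eqP|//].
by rewrite (negPf (charB n)).
Qed.

(** The products of [e i] with the monomials of degree at most [n] in the uniformizers at [q i] are
    independent over [B] modulo the local power, which is spanned over by the monomials counted on
    the right. *)
Lemma local_length_bound d n : (forall x, spanned d (local_power 1) x) ->
  (#|I| * #|{: 'X_{1..r < n.+1}}| <= #|{: 'X_{1..r < (D * n + d).+1}}|)%N.
Proof.
move=> span; rewrite leqNgt; apply/negP => lt.
have [h hh] : exists h : I -> 'I_r -> A, forall i v, [/\ q i (h i v),
    forall w, w != v -> (h i v)^`M(w) = 0 & ~ q i (h i v)^`M(v)].
  by apply: (@fin_all_exists _ _ _ uniformizers).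
have [e he] := local_idempotents n.+1.
have [|||v [[[i m1] vi] hv]] := @dependent_mod B r (local_power n.+1) (D * n + d)
    (I * 'X_{1..r < n.+1})%type (fun z => e z.1 * \prod_w h z.1 w ^+ z.2 w).
- exact: local_power_ideal.
- by move=> z; apply: all_spanned.
- by rewrite card_prod.
(* With [m] of least degree among the nonzero coefficients at [i], the relation at [q i] starts in
   degree [mdeg m]. *)
case: (@arg_minnP _ m1 (fun m => v (i, m) != 0) (fun m => mdeg m) vi) => m v0 mmin.
case: hv => s [os hs].
have /fin_all_exists [t ht] (j : I) : exists t, ~ q i t /\ (j != i -> ipow G n.+1 (t * e j)).
  have [->|ji] := eqVneq j i; first by exists 1; split=> //; apply: outside1.
  by case: (he j) => _ /(_ i); rewrite eq_sym => /(_ ji) [t [nt h1]]; exists t.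
(* Multiplication by [T] sends the terms of all [j] other than [i] into the power of the ideal. *)
pose T := \prod_j t j.
have nT : ~ q i T by apply: prime_nprod => // j _; case: (ht j).
pose F : {mpoly A[r]} := \sum_(m' : 'X_{1..r < n.+1})
   (s * T * e i * (v (i, m'))%:MP) *: 'X_[m'].
have cF (m' : 'X_{1..r < n.+1}) : F@_m' = s * T * e i * (v (i, m'))%:MP.
  rewrite /F raddf_sum /= (bigD1 m') //= mcoeffZ mcoeffX eqxx mulr1 big1 ?addr0 //.
  move=> m2 ne; rewrite mcoeffZ mcoeffX.
  by rewrite (_ : (_ == _) = false) ?mulr0 //; apply/negbTE; apply: contra ne => /eqP /val_inj ->.
have eF : ipow G n.+1 F.@[h i].
  have idG := ipow_ideal G n.+1.
  apply: (@ring_idealBK _ _ _ (T * (s * \sum_z (v z)%:MP * (e z.1 * \prod_w h z.1 w ^+ z.2 w)))) => //;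
    last exact: ring_idealMl.
  rewrite -opprB; apply: ring_idealN => //.
  pose f (j : I) (m' : 'X_{1..r < n.+1}) := T * (s * ((v (j, m'))%:MP * (e j * \prod_w h j w ^+ m' w))).
  have -> : T * (s * \sum_z (v z)%:MP * (e z.1 * \prod_w h z.1 w ^+ z.2 w))
      = \sum_j \sum_m' f j m'.
    rewrite !mulr_sumr pair_bigA; apply: eq_bigr => -[j m'] _; by [].
  have -> : F.@[h i] = \sum_m' f i m'.
    rewrite /F raddf_sum; apply: eq_bigr => m' _ /=; rewrite mevalZ mevalX /f; ring.
  rewrite (bigD1 i) //= [X in X - _]addrC addrK; apply: ring_ideal_sum => // j ji.
  apply: ring_ideal_sum => // m' _; rewrite /f /T (bigD1 j) //=.
  set X := \prod_(_ | _) _; set Y := \prod_w _.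
  have -> : t j * X * (s * ((v (j, m'))%:MP * (e j * Y))) =
     (X * s * (v (j, m'))%:MP * Y) * (t j * e j) by ring.
  by apply: ring_idealMl => //; case: (ht j) => _; apply.
have : q i F@_m.
  apply: (@gr_independent _ _ (q i) (h i) (primeq i) _ _ _ _ (mdeg m)) => //.
  - exact: charq.
  - by move=> w; case: (hh i w).
  - by move=> w w'; case: (hh i w) => _ + _; apply.
  - by move=> w; case: (hh i w).
  - move=> m' lt'; have lt1 : (mdeg m' < n.+1)%N by apply: ltn_trans lt' (bmdeg m).
    rewrite (cF (BMultinom lt1)); apply/eqP; rewrite mulf_eq0 orbC.
    apply/orP; left; rewrite mpolyC_eq0; apply: contraLR lt' => v1.
    by rewrite -leqNgt; apply: (mmin (BMultinom lt1)).
  - apply: (@ipow_le _ _ _ n.+1); first by rewrite bmdeg.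
    by apply: ipow_incl eF => y; apply: Gq.
rewrite cF; apply: prime_nM => //; last by move=> /qB /eqP; rewrite (negPf v0).
by apply: prime_nM => //; [apply: prime_nM => //; apply: os | case: (he i)].
Qed.

Theorem bezout_isolated : (0 < D)%N -> (#|I| <= D ^ r)%N.
Proof.
move=> D0; have [|d span] := algebraic_spanned (local_power_ideal 1).
  exact: local_algebraic.
apply: (@asymptotic_ratio _ _ d r); first by rewrite expn_gt0 D0.
move=> n; apply: leq_trans (local_length_bound n span) _.
exact: card_bmultinom_scale.
Qed.

End IsolatedPrimes.

(** * Transcendence bases *)

Lemma ring_prime_preim (R S : comNzRingType) (f : {rmorphism R -> S}) (P : S -> Prop) :
  ring_prime P -> ring_prime (fun x => P (f x)).
Proof.
move=> hP; have idP := prime_ideal hP; case: hP => _ P1 PM; split.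
- split; first by rewrite rmorph0; apply: ring_ideal0.
  split=> [a b|x a]; first by rewrite rmorphD; apply: ring_idealD.
  by rewrite rmorphM; apply: ring_idealMl.
- by rewrite rmorph1.
- by move=> a b; rewrite rmorphM; apply: PM.
Qed.

Lemma ipow_morph (R S : comNzRingType) (f : {rmorphism R -> S})
    (G : R -> Prop) (G' : S -> Prop) n x :
  (forall y, G y -> G' (f y)) -> ipow G n x -> ipow G' n (f x).
Proof.
move=> GG; elim=> {n x} [x|n|n y g Gf _ IH|n x y _ IHx _ IHy].
- exact: ipow_all.
- by rewrite rmorph0; apply: ipow_zero.
- by rewrite rmorphM; apply: ipow_gen => //; apply: GG.
- by rewrite rmorphD; apply: ipow_add.
Qed.

Lemma mpoly_rmorph_ext (R : comNzRingType) n (S : comNzRingType)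
    (f g : {rmorphism {mpoly R[n]} -> S}) :
  (forall c, f c%:MP = g c%:MP) -> (forall i, f 'X_i = g 'X_i) -> f =1 g.
Proof.
move=> hC hX x; rewrite [x]mpolyE !rmorph_sum; apply: eq_bigr => m _.
rewrite -mul_mpolyC !rmorphM hC mpolyXE_id !rmorph_prod; congr (_ * _).
by apply: eq_bigr => i _; rewrite !rmorphXn hX.
Qed.

Lemma msize_prod_linear (B : idomainType) r (I : Type) (s : seq I)
    (a : I -> {mpoly B[r]}) (l : I -> nat) :
  (forall i, (msize (a i) <= 2)%N) ->
  (msize (\prod_(i <- s) a i ^+ l i) <= (\sum_(i <- s) l i).+1)%N.
Proof.
have mul (x y : {mpoly B[r]}) d e : (msize x <= d.+1)%N -> (msize y <= e.+1)%N ->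
    (msize (x * y) <= (d + e).+1)%N.
  have [->|x0] := eqVneq x 0; first by rewrite mul0r msize0.
  have [->|y0] := eqVneq y 0; first by rewrite mulr0 msize0.
  by rewrite msizeM //; lia.
move=> ha; apply: (big_ind2 (fun (x : {mpoly B[r]}) d => (msize x <= d.+1)%N)).
- by rewrite msize1.
- by move=> x d y e; apply: mul.
- move=> i _; elim: (l i) => [|j IH]; first by rewrite expr0 msize1.
  by rewrite exprS; apply: (mul _ _ 1%N j).
Qed.

Section Variables.
Variables (k : fieldType) (n : nat).
Local Notation R := {mpoly k[n]}.
Implicit Types (P Q : R -> Prop) (S T : {set 'I_n}).

Inductive vars_in S : R -> Prop :=
| vars_inC c : vars_in S c%:MP
| vars_inX i : i \in S -> vars_in S 'X_i
| vars_inD f g : vars_in S f -> vars_in S g -> vars_in S (f + g)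
| vars_inM f g : vars_in S f -> vars_in S g -> vars_in S (f * g).

Lemma vars_in_sum S (I : Type) (s : seq I) (C : pred I) (F : I -> R) :
  (forall i, C i -> vars_in S (F i)) -> vars_in S (\sum_(i <- s | C i) F i).
Proof.
move=> h; apply: big_ind => //; first by rewrite -(mpolyC0 n k); apply: vars_inC.
exact: vars_inD.
Qed.

Lemma vars_in_prod S (I : Type) (s : seq I) (C : pred I) (F : I -> R) :
  (forall i, C i -> vars_in S (F i)) -> vars_in S (\prod_(i <- s | C i) F i).
Proof.
move=> h; apply: big_ind => //; first by rewrite -(mpolyC1 n k); apply: vars_inC.
exact: vars_inM.
Qed.

Lemma vars_inXn S f l : vars_in S f -> vars_in S (f ^+ l).
Proof.
move=> h; elim: l => [|l IH]; last by rewrite exprS; apply: vars_inM.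
by rewrite expr0 -(mpolyC1 n k); apply: vars_inC.
Qed.

Lemma vars_in_incl S T f : S \subset T -> vars_in S f -> vars_in T f.
Proof.
move=> /subsetP ST; elim=> [c|i /ST iT|{}f g _ hf _ hg|{}f g _ hf _ hg].
- exact: vars_inC.
- exact: vars_inX.
- exact: vars_inD.
- exact: vars_inM.
Qed.

Lemma vars_in_setT f : vars_in setT f.
Proof.
rewrite [f]mpolyE; apply: vars_in_sum => m _; rewrite -mul_mpolyC.
apply: vars_inM; first exact: vars_inC.
rewrite mpolyXE_id; apply: vars_in_prod => i _; apply/vars_inXn/vars_inX.
by rewrite inE.
Qed.

Lemma vars_in_set0 f : vars_in set0 f -> exists c, f = c%:MP.
Proof.
elim=> [c|i|{}f g _ [c ->] _ [d ->]|{}f g _ [c ->] _ [d ->]].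
- by exists c.
- by rewrite inE.
- by exists (c + d); rewrite mpolyCD.
- by exists (c * d); rewrite mpolyCM.
Qed.

Local Notation Base S := {mpoly k[#|S|]}.
Local Notation Alg S := {mpoly {mpoly k[#|S|]}[#|~: S|]}.

(** The last clause, that degrees do not grow when the variables in [S] become constants, carries
    over the degree bound on the generators. *)
Lemma split_variables S :
  exists (phi : {rmorphism Alg S -> R})
         (psi : {rmorphism R -> Alg S}),
  [/\ cancel phi psi /\ cancel psi phi,
      forall b, vars_in S (phi b%:MP),
      forall v, phi 'X_v = 'X_(enum_val v),
      (forall i, i \in S -> exists b, phi b%:MP = 'X_i) /\
      (forall c, exists b, phi b%:MP = c%:MP)
    & forall g, (msize (psi g) <= msize g)%N].
Proof.
pose iota : {rmorphism Base S -> R} :=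
  GRing.RMorphism.clone _ _ (mmap (@mpolyC n k) (fun i : 'I_#|S| => 'X_(enum_val i))) _.
pose phi : {rmorphism Alg S -> R} :=
  GRing.RMorphism.clone _ _ (mmap iota (fun i : 'I_#|~: S| => 'X_(enum_val i))) _.
pose a (i : 'I_n) : Alg S :=
  if [pick j : 'I_#|S| | enum_val j == i] is Some j then ('X_j)%:MP
  else if [pick j : 'I_#|~: S| | enum_val j == i] is Some j then 'X_j else 0.
pose psi : {rmorphism R -> Alg S} :=
  GRing.RMorphism.clone _ _ (mmap (@mpolyC #|~: S| (Base S) \o @mpolyC #|S| k) a) _.
have aS (j : 'I_#|S|) : a (enum_val j) = ('X_j)%:MP.
  rewrite /a; case: pickP => [j' /eqP /enum_val_inj -> //|/(_ j)]; by rewrite eqxx.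
have aC (j : 'I_#|~: S|) : a (enum_val j) = 'X_j.
  rewrite /a; case: pickP => [j' /eqP e|_].
    by have := enum_valP j; rewrite -e inE enum_valP.
  by case: pickP => [j' /eqP /enum_val_inj -> //|/(_ j)]; rewrite eqxx.
have iotaX j : iota 'X_j = 'X_(enum_val j) by rewrite /= mmapX mmap1U.
have iotaC c : iota c%:MP = c%:MP by rewrite /= mmapC.
have phiX j : phi 'X_j = 'X_(enum_val j) by rewrite /= mmapX mmap1U.
have phiC c : phi c%:MP = iota c by rewrite /= mmapC.
have psiX i : psi 'X_i = a i by rewrite /= mmapX mmap1U.
have psiC c : psi c%:MP = (c%:MP)%:MP by rewrite /= mmapC.
exists phi, psi; split.
- split.
    apply: (@mpoly_rmorph_ext _ _ _ (GRing.RMorphism.clone _ _ (psi \o phi) _)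
      (GRing.RMorphism.clone _ _ idfun _)) => [b|i].
      change (psi (phi b%:MP) = b%:MP); rewrite phiC.
      apply: (@mpoly_rmorph_ext _ _ _ (GRing.RMorphism.clone _ _ (psi \o iota) _)
        (GRing.RMorphism.clone _ _ (@mpolyC _ (Base S)) _)) => [c|i].
        by change (psi (iota c%:MP) = c%:MP%:MP); rewrite iotaC psiC.
      by change (psi (iota 'X_i) = ('X_i)%:MP); rewrite iotaX psiX aS.
    by change (psi (phi 'X_i) = 'X_i); rewrite phiX psiX aC.
  apply: (@mpoly_rmorph_ext _ _ _ (GRing.RMorphism.clone _ _ (phi \o psi) _)
      (GRing.RMorphism.clone _ _ idfun _)) => [c|i].
    by change (phi (psi c%:MP) = c%:MP); rewrite psiC phiC iotaC.
  change (phi (psi 'X_i) = 'X_i); rewrite psiX.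
  have [iS|iS] := boolP (i \in S).
    by rewrite -(enum_rankK_in iS iS) aS phiC iotaX.
  have iC : i \in ~: S by rewrite inE.
  by rewrite -(enum_rankK_in iC iC) aC phiX.
- move=> b; rewrite phiC /= /mmap; apply: vars_in_sum => m _.
  apply: vars_inM; first exact: vars_inC.
  by apply: vars_in_prod => j _; apply/vars_inXn/vars_inX/enum_valP.
- exact: phiX.
- split=> [i iS|c]; last by exists c%:MP; rewrite phiC iotaC.
  by exists 'X_(enum_rank_in iS i); rewrite phiC iotaX enum_rankK_in.
- have a2 i : (msize (a i) <= 2)%N.
    rewrite /a; case: pickP => [j _|_]; first by rewrite msizeC; case: (_ != _).
    by case: pickP => [j _|_]; rewrite ?msize0 // msizeX mdeg1.
  move=> g; rewrite /= /mmap; apply: leq_trans (msize_sum _ _ _) _.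
  apply/bigmax_leqP_seq => m mg _; apply: leq_trans (msize_mdeg_lt mg).
  rewrite mul_mpolyC; apply: leq_trans (msizeZ_le _ _) _.
  by rewrite mdegE; apply: msize_prod_linear.
Qed.

Definition indep P S := forall g, vars_in S g -> P g -> g = 0.

Lemma indep_incl P Q S : (forall g, P g -> Q g) -> indep Q S -> indep P S.
Proof. by move=> PQ hQ g vg /PQ; apply: hQ. Qed.

Lemma indep_set0 P : ring_prime P -> indep P set0.
Proof.
move=> [idP P1 _] g /vars_in_set0 [c ->] Pc; apply: NNPP => c0; apply: P1.
have nz : c != 0 by apply/eqP => e; apply: c0; rewrite e mpolyC0.
have -> : 1 = (c^-1)%:MP * c%:MP :> R by rewrite -mpolyCM mulVf ?mpolyC1.
exact: ring_idealMl.
Qed.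

Definition transc_basis P S := indep P S /\ forall v, v \notin S -> ~ indep P (v |: S).

Lemma split_residue S :
  exists (phi : {rmorphism Alg S -> R})
         (psi : {rmorphism R -> Alg S}),
  [/\ cancel phi psi /\ cancel psi phi,
      forall g, (msize (psi g) <= msize g)%N,
      forall Q, indep Q S -> forall b, Q (phi b%:MP) -> b = 0
    & forall Q, transc_basis Q S ->
        forall v, exists p, p != 0 /\ Q (phi (poly_at 'X_v p))].
Proof.
have [phi [psi [[phiK psiK] phiB phiX [phiS phiC] sz]]] := split_variables S.
exists phi, psi; split=> //.
  move=> Q iQ b /(iQ _ (phiB b)) e; apply: (@mpolyC_injective #|~: S|).
  by apply: (can_inj phiK); rewrite e mpolyC0 rmorph0.
move=> Q [_ maxQ] v.
have vS : enum_val v \notin S by have := enum_valP v; rewrite inE.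
have [g [vg [Qg g0]]] : exists g, vars_in (enum_val v |: S) g /\ (Q g /\ g <> 0).
  apply: NNPP => no; apply: (maxQ _ vS) => g vg Qg; apply: NNPP => g0.
  by apply: no; exists g.
have [p ep] : exists p, g = phi (poly_at 'X_v p).
  elim: vg => [c|i|f f' _ [p ->] _ [p' ->]|f f' _ [p ->] _ [p' ->]].
  - by have [b <-] := phiC c; exists b%:P; rewrite poly_atC.
  - rewrite !inE => /orP [/eqP ->|/phiS [b <-]].
      by exists 'X; rewrite poly_atX phiX.
    by exists b%:P; rewrite poly_atC.
  - by exists (p + p'); rewrite poly_atD rmorphD.
  - by exists (p * p'); rewrite poly_atM rmorphM.
exists p; split; last by rewrite -ep.
by apply: contra_notN g0 => /eqP p0; rewrite ep p0 poly_at0 rmorph0.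
Qed.

(** If [g] in [Q] were outside [P], [inverse_mod] would put a nonzero polynomial in the variables of
    [S] into (g) + P, hence into [Q]. *)
Lemma prime_eq_of_basis P Q S : ring_prime P -> ring_prime Q ->
  (forall g, P g -> Q g) -> transc_basis P S -> indep Q S -> forall g, Q g -> P g.
Proof.
move=> hP hQ PQ bP iQ g Qg; apply: NNPP => nPg.
have [phi [psi [[phiK psiK] _ hB halg]]] := split_residue S.
have hP' := ring_prime_preim phi hP.
have [d span] := algebraic_spanned (prime_ideal hP') (halg _ bP).
have [|c [t [c0 Pt]]] := @inverse_mod _ _ _ d (psi g) (prime_ideal hP') span.
  move=> x; rewrite rmorphM psiK; case: hP => _ _ h /h [] //.
move/eqP: c0; apply; apply: (hB _ iQ).
move: Pt; rewrite rmorphD rmorphM psiK => /PQ h.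
have -> : phi c%:MP = g * phi t + phi c%:MP - g * phi t by rewrite addrC addKr.
have idQ := prime_ideal hQ.
by apply: ring_idealB => //; apply: ring_idealMr.
Qed.

Definition pdim P := \max_(S : {set 'I_n} | boolp.asbool (indep P S)) #|S|.

Lemma pdim_max P S : indep P S -> (#|S| <= pdim P)%N.
Proof.
by move=> h; apply: (@leq_bigmax_cond _ (fun S => boolp.asbool _)
  (fun S : {set 'I_n} => #|S|)); apply/boolp.asboolP.
Qed.

Lemma pdim_le P : (pdim P <= n)%N.
Proof. by apply/bigmax_leqP => S _; rewrite -[X in (_ <= X)%N]card_ord max_card. Qed.

Lemma basis_of_card P S : indep P S -> #|S| = pdim P -> transc_basis P S.
Proof.
move=> iS e; split=> // v vS /pdim_max.
by rewrite -e cardsU1 vS add1n ltnn.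
Qed.

Lemma pdim_basis P : ring_prime P -> exists S, transc_basis P S /\ #|S| = pdim P.
Proof.
move=> hP; have h0 : boolp.asbool (indep P set0) by apply/boolp.asboolP/indep_set0.
have [|S /boolp.asboolP iS e] := @eq_bigmax_cond _ (fun S => boolp.asbool (indep P S))
    (fun S : {set 'I_n} => #|S|).
  by apply/card_gt0P; exists set0.
by exists S; split=> //; apply: basis_of_card.
Qed.

(** A basis for [Q] is independent modulo [P]; if the numbers agreed, it would be a basis for [P]
    too and the primes would coincide. *)
Lemma pdim_strict P Q : ring_prime P -> ring_prime Q ->
  (forall g, P g -> Q g) -> (exists g, Q g /\ ~ P g) -> (pdim Q < pdim P)%N.
Proof.
move=> hP hQ PQ [g [Qg nPg]].
have [S [[iS _] eS]] := pdim_basis hQ.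
have iP := indep_incl PQ iS.
rewrite ltn_neqAle -eS pdim_max // andbT; apply/eqP => e.
by apply: nPg; apply: (prime_eq_of_basis hP hQ PQ (basis_of_card iP e) iS).
Qed.

Lemma bezout_basis (I : finType) (q : I -> R -> Prop) (G : R -> Prop) D S :
    [pchar k] =i pred0 ->
    (forall i, ring_prime (q i)) -> (forall i, transc_basis (q i) S) ->
    (forall f, G f -> (msize f <= D.+1)%N) -> (forall i f, G f -> q i f) ->
    (forall i j, i != j -> exists g, q i g /\ ~ q j g) ->
    (forall i g, q i g -> exists s l, ~ q i s /\ ipow G 1 (s * g ^+ l)) ->
    (0 < D)%N ->
  (#|I| <= D ^ (n - #|S|))%N.
Proof.
move=> chark primeq bq Gdeg Gq qsep qrad D0.
have [phi [psi [[phiK psiK] sz hB halg]]] := split_residue S.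
have -> : (n - #|S| = #|~: S|)%N by rewrite [RHS]cardsCs setCK card_ord.
apply: (@bezout_isolated {mpoly k[#|S|]} #|~: S| _ I (fun i x => q i (phi x))
  (fun x => G (phi x)) D) => //.
- move=> l; rewrite -(rmorph_nat (@mpolyC #|S| k)) mpolyC_eq0.
  by have /charf0P -> := chark.
- by move=> i; apply: ring_prime_preim.
- by move=> i; apply: hB; case: (bq i).
- by move=> i; apply: halg.
- by move=> f Gf; rewrite -(phiK f); apply: leq_trans (sz _) _; apply: Gdeg.
- by move=> i f; apply: Gq.
- by move=> i j /qsep [g [qg ng]]; exists (psi g); rewrite psiK.
- move=> i g /qrad [s [l [ns h]]]; exists (psi s), l; rewrite psiK; split=> //.
  rewrite -[g]phiK -rmorphXn -rmorphM; apply: ipow_morph h => y Gy.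
  by rewrite psiK.
Qed.

End Variables.

(** * Heights *)

Lemma coef_ideal (R : comNzRingType) n (Q : R -> Prop) : ring_ideal Q ->
  ring_ideal (fun F : {mpoly R[n]} => forall m, Q F@_m).
Proof.
move=> hQ; split; first by move=> m; rewrite mcoeff0; apply: ring_ideal0.
split=> [F G hF hG m|F G hG m]; first by rewrite mcoeffD; apply: ring_idealD.
by rewrite mcoeffM; apply: ring_ideal_sum => // i _; apply: ring_idealMl.
Qed.

Lemma coef_prime (R : idomainType) n (Q : R -> Prop) : ring_prime Q ->
  ring_prime (fun F : {mpoly R[n]} => forall m, Q F@_m).
Proof.
move=> hQ; have idQ := prime_ideal hQ; have idQX := coef_ideal n idQ.
split=> //.
  by move=> /(_ 0%MM); rewrite mcoeff1 eqxx; case: hQ.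
(* Drop the coefficients in Q: the product of the leading coefficients survives. *)
have trunc (F : {mpoly R[n]}) : ~ (forall m, Q F@_m) -> exists F' : {mpoly R[n]},
    (forall m, Q (F - F')@_m) /\ ~ Q (mleadc F').
  move=> nF; pose t m := if boolp.asbool (Q F@_m) then 0 else F@_m.
  pose F' := \sum_(m <- msupp F) t m *: 'X_[m].
  have cF' m : F'@_m = t m.
    rewrite /F' raddf_sum /=; have [mF|mF] := boolP (m \in msupp F).
      rewrite (bigD1_seq m) ?msupp_uniq //= mcoeffZ mcoeffX eqxx mulr1 big1 ?addr0 //.
      by move=> m' /negPf ne; rewrite mcoeffZ mcoeffX ne mulr0.
    rewrite /t memN_msupp_eq0 // if_same big_seq big1 // => m' m'F.
    rewrite mcoeffZ mcoeffX (_ : (_ == _) = false) ?mulr0 //.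
    by apply: contraNF mF => /eqP <-.
  rewrite /t in cF'.
  exists F'; split.
    move=> m; rewrite mcoeffB cF'; case: ifPn => [/boolp.asboolP|_]; first by rewrite subr0.
    by rewrite subrr; apply: ring_ideal0.
  have F'0 : F' != 0.
    apply: contra_notN nF => /eqP F'0 m; have := cF' m; rewrite F'0 mcoeff0.
    by case: ifPn => [/boolp.asboolP //|_ <-]; apply: ring_ideal0.
  have := mleadc_eq0 F'; rewrite (negPf F'0) cF'; case: ifPn; first by rewrite eqxx.
  by move=> /boolp.asboolP.
move=> F G QFG; apply: NNPP => /not_or_and [/trunc [F' [hF lF]] /trunc [G' [hG lG]]].
have : Q (F' * G')@_(mlead F' + mlead G')%MM.
  have -> : F' * G' = F * G - ((F - F') * G + F' * (G - G')) by ring.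
  move: (mlead F' + mlead G')%MM; apply: (ring_idealB idQX) => //.
  by apply: (ring_idealD idQX); [apply: (ring_idealMr _ idQX) | apply: (ring_idealMl _ idQX)].
by rewrite mleadcM; apply: prime_nM.
Qed.

Section Flags.
Variables (k : fieldType) (n : nat).
Local Notation R := {mpoly k[n]}.
Implicit Types (P Q : R -> Prop) (S T : {set 'I_n}).

(** Moves the variables in [S] into the coefficients. Both layers keep all [n] indices, so that all
    [S] share one target ring. *)
Definition split_at S : {rmorphism R -> {mpoly R[n]}} :=
  GRing.RMorphism.clone _ _ (mmap (@mpolyC n {mpoly k[n]} \o @mpolyC n k)
    (fun i => if i \in S then ('X_i)%:MP else 'X_i)) _.

Lemma split_atC S c : split_at S c%:MP = (c%:MP)%:MP.
Proof. by rewrite /= mmapC. Qed.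

Lemma split_atX S i : split_at S 'X_i = if i \in S then ('X_i)%:MP else 'X_i.
Proof. by rewrite /= mmapX mmap1U. Qed.

Lemma split_atD S f g : split_at S (f + g) = split_at S f + split_at S g.
Proof. exact: rmorphD. Qed.

Lemma split_atM S f g : split_at S (f * g) = split_at S f * split_at S g.
Proof. exact: rmorphM. Qed.

Opaque split_at.

Lemma split_at_vars_in S g : vars_in S g -> split_at S g = g%:MP.
Proof.
elim=> [c|i iS|f h _ IHf _ IHh|f h _ IHf _ IHh].
- by rewrite split_atC.
- by rewrite split_atX iS.
- by rewrite split_atD IHf IHh mpolyCD.
- by rewrite split_atM IHf IHh mpolyCM.
Qed.

Lemma split_at_coef S T g m : vars_in T g -> vars_in (T :&: S) (split_at S g)@_m.
Proof.
move=> vg; elim: vg m => [c|i iT|f h _ IHf _ IHh|f h _ IHf _ IHh] m.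
- rewrite split_atC mcoeffC; case: (m == _); rewrite ?mulr1 ?mulr0.
    exact: vars_inC.
  by rewrite -(mpolyC0 n k); apply: vars_inC.
- rewrite split_atX; case: ifP => iS; rewrite ?mcoeffC ?mcoeffX; case: (_ == _);
    rewrite ?mulr1 ?mulr0 -?(mpolyC0 n k) -?(mpolyC1 n k); try exact: vars_inC.
  by apply: vars_inX; rewrite inE iT.
- rewrite split_atD mcoeffD; exact: vars_inD (IHf m) (IHh m).
- rewrite split_atM mcoeffM; apply: vars_in_sum => i _.
  exact: vars_inM (IHf _) (IHh _).
Qed.

Lemma split_atK S g : (split_at S g).@[fun i => 'X_i] = g.
Proof.
apply: (@mpoly_rmorph_ext _ _ _ (GRing.RMorphism.clone _ _ (meval (fun i => 'X_i) \o split_at S) _)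
      (GRing.RMorphism.clone _ _ idfun _)) => [c|i].
  by change ((split_at S c%:MP).@[fun i => 'X_i] = c%:MP); rewrite split_atC mevalC.
change ((split_at S 'X_i).@[fun i => 'X_i] = 'X_i); rewrite split_atX.
by case: ifP => _; rewrite ?mevalC ?mevalXU.
Qed.

(* The extension to k[t_1..t_n] of the contraction of Q to the variables in S. *)
Definition flag_prime Q S g := forall m, Q (split_at S g)@_m.

Lemma flag_prime_prime Q S : ring_prime Q -> ring_prime (flag_prime Q S).
Proof. by move=> hQ; apply: (ring_prime_preim (split_at S) (coef_prime n hQ)). Qed.

Lemma flag_prime_vars_in Q S g : ring_ideal Q -> vars_in S g ->
  flag_prime Q S g <-> Q g.
Proof.
move=> idQ vg; rewrite /flag_prime (split_at_vars_in vg); split.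
  by move=> /(_ 0%MM); rewrite mcoeffC eqxx mulr1.
by move=> Qg m; rewrite mcoeffC; apply: ring_idealMr.
Qed.

Lemma flag_prime_incl Q S T g : ring_ideal Q -> S \subset T ->
  flag_prime Q S g -> flag_prime Q T g.
Proof.
move=> idQ ST hg; have idQX := coef_ideal n idQ.
rewrite /flag_prime -(split_atK S g) mevalE (rmorph_sum (split_at T)).
apply: (ring_ideal_sum _ idQX) => m _; rewrite split_atM; apply: (ring_idealMr _ idQX).
have vm : vars_in T (split_at S g)@_m.
  apply: (@vars_in_incl _ _ (setT :&: S)); first by rewrite setTI.
  exact/split_at_coef/vars_in_setT.
by apply/(flag_prime_vars_in idQ vm).
Qed.

Lemma chain_extend P Q l : ring_prime Q -> psub_strict P Q ->
  has_prime_chain P l -> has_prime_chain Q l.+1.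
Proof.
move=> hQ [PQ [g [Qg nPg]]] [c [hc sc ec]].
exists (fun i => if (i <= l)%N then c i else Q); split.
- by move=> i _; case: ifP => [il|_] //; apply: hc.
- move=> i; rewrite ltnS => il; rewrite il; case: ltnP => [il'|li]; first exact: sc.
  have -> : i = l by apply/eqP; rewrite eqn_leq il.
  split; first by move=> x /ec /PQ.
  by exists g; split=> // /ec.
- by rewrite ltnn.
Qed.

Lemma chain_eq P Q l : pseteq P Q -> has_prime_chain P l -> has_prime_chain Q l.
Proof.
move=> PQ [c [hc sc ec]]; exists c; split=> // g.
by split=> [/ec /PQ|/PQ /ec].
Qed.

Lemma pdim_eq P Q : pseteq P Q -> pdim P = pdim Q.
Proof.
move=> PQ; apply: eq_bigl => S; congr boolp.asbool; apply: boolp.propext.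
by split; apply: indep_incl => g /PQ.
Qed.

Lemma pdim_chain P l : has_prime_chain P l -> (pdim P + l <= n)%N.
Proof.
case=> c [hc sc /pdim_eq <-].
suff h i : (i <= l)%N -> (pdim (c i) + i <= n)%N by apply: h.
elim: i => [|i IH] il; first by rewrite addn0 pdim_le.
have [PQ ex] := sc i il.
have := pdim_strict (hc i (ltnW il)) (hc i.+1 il) PQ ex.
have := IH (ltnW il); lia.
Qed.

(** The variables enter one by one. Either the flag prime grows, which lengthens the chain, or it
    stays the same, and then the new variable is independent of [T] modulo [Q] and joins [T]. So the
    length and [#|T|] add up to [i]. *)
Lemma flag_chain Q i : ring_prime Q -> (i <= n)%N ->
  exists T : {set 'I_n}, [/\ T \subset [set j : 'I_n | (j < i)%N], indep Q T
    & has_prime_chain (flag_prime Q [set j : 'I_n | (j < i)%N]) (i - #|T|)].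
Proof.
move=> hQ; have idQ := prime_ideal hQ; elim: i => [|i IH] ltin.
  exists set0; split; [by rewrite sub0set | exact: indep_set0 |].
  exists (fun _ => flag_prime Q [set j : 'I_n | (j < 0)%N]); split=> [j _|j|g].
  - exact: flag_prime_prime.
  - by rewrite sub0n ltn0.
  - exact: iff_refl.
have [T [TA iT cT]] := IH (ltnW ltin).
set A := [set j : 'I_n | (j < i)%N] in TA cT *.
set A' := [set j : 'I_n | (j < i.+1)%N].
have AA' : A \subset A' by apply/subsetP => j; rewrite !inE => /ltnW.
pose v := Ordinal ltin.
have vT : v \notin T by apply/negP => /(subsetP TA); rewrite inE ltnn.
have cardT : (#|T| <= i)%N.
  have inj : injective (fun j : 'I_i => widen_ord (ltnW ltin) j).
    by move=> j j' /(congr1 val) /= /val_inj.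
  rewrite -[X in (_ <= X)%N]card_ord -(card_codom inj); apply: subset_leq_card.
  apply/subsetP => j /(subsetP TA); rewrite inE => ji; apply/codomP.
  by exists (Ordinal ji); apply: val_inj.
have [strict|eqA] := classic (exists g, flag_prime Q A' g /\ ~ flag_prime Q A g).
  exists T; split; [exact: subset_trans TA AA' | exact: iT |].
  rewrite (subSn cardT); apply: chain_extend cT; first exact: flag_prime_prime.
  split; last exact: strict.
  by move=> g; exact: flag_prime_incl.
exists (v |: T); split.
- by rewrite subUset sub1set inE ltnSn /=; apply: subset_trans AA'.
- move=> g vg Qg.
  have vA' : vars_in A' g.
    apply: vars_in_incl vg; rewrite subUset sub1set inE ltnSn /=; exact: subset_trans AA'.
  (* As the flag prime did not grow, the coefficients of [g] with respect to [A] lie in [Q]; they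
     involve only variables in [T], so they vanish. *)
  have hA : flag_prime Q A g.
    apply: NNPP => nA; apply: eqA; exists g; split; last exact: nA.
    by apply/(flag_prime_vars_in idQ vA').
  rewrite -(split_atK A g) (_ : split_at A g = 0) ?meval0 //.
  apply/mpolyP => m; rewrite mcoeff0; apply: iT (hA m).
  apply: vars_in_incl (split_at_coef A m vg); apply/subsetP => j; rewrite !inE.
  case/andP => /orP [/eqP ->|//]; by rewrite /= ltnn.
- rewrite cardsU1 vT add1n subSS; apply: chain_eq cT => g; split; first exact: flag_prime_incl.
  by move=> gA'; apply: NNPP => nA; exact: eqA (ex_intro _ g (conj gA' nA)).
Qed.

(** The flag over all variables ends at [P] with length [n - #|T|]; [pdim_chain] bounds the length
    of every chain, and [#|T| <= pdim P] makes the two bounds meet. *)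
Lemma height_pdim P : ring_prime P -> height_eq P (n - pdim P).
Proof.
move=> hP; split; last by move=> /pdim_chain; have := pdim_le P; lia.
have [T [_ iT cT]] := flag_chain hP (leqnn n).
have : pseteq (flag_prime P [set j : 'I_n | (j < n)%N]) P.
  move=> g; apply: flag_prime_vars_in; first exact: prime_ideal.
  apply: vars_in_incl (vars_in_setT g); apply/subsetP => j _; by rewrite inE ltn_ord.
move=> /chain_eq /(_ cT) cP.
suff -> : (n - pdim P = n - #|T|)%N by [].
have := pdim_max iT; have := pdim_chain cP; have := pdim_le P; lia.
Qed.

End Flags.

(** * Torus action and lattice rank *)

Section TorusAction.
Variables (k : fieldType) (n : nat).
Local Notation R := {mpoly k[n]}.
Implicit Types (P Q : R -> Prop) (S : {set 'I_n}) (z w : 'I_n -> k).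

Definition zact_rmorphism z : {rmorphism R -> R} :=
  GRing.RMorphism.clone _ _ (comp_mpoly [tuple (z i)%:MP * 'X_i | i < n]) _.

Lemma zactC z c : zact z c%:MP = c%:MP.
Proof. exact: comp_mpolyC. Qed.

Lemma zactX z i : zact z 'X_i = (z i)%:MP * 'X_i.
Proof. by rewrite /zact comp_mpolyXU -tnth_nth tnth_mktuple. Qed.

Lemma zact_eq z w g : z =1 w -> zact z g = zact w g.
Proof.
move=> e; rewrite /zact; congr (_ \mPo _).
by apply: eq_from_tnth => i; rewrite !tnth_mktuple e.
Qed.

Lemma zact1 z g : (forall i, z i = 1) -> zact z g = g.
Proof.
move=> z1; rewrite -[RHS](comp_mpoly_id g) /zact; congr (_ \mPo _).
by apply: eq_from_tnth => i; rewrite !tnth_mktuple z1 mpolyC1 mul1r.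
Qed.

Lemma zactM z w g : zact z (zact w g) = zact (fun i => z i * w i) g.
Proof.
apply: (@mpoly_rmorph_ext _ _ _
  (GRing.RMorphism.clone _ _ (zact_rmorphism z \o zact_rmorphism w) _)
  (zact_rmorphism (fun i => z i * w i))) => [c|i].
  by change (zact z (zact w c%:MP) = zact (fun i => z i * w i) c%:MP); rewrite !zactC.
change (zact z (zact w 'X_i) = zact (fun i => z i * w i) 'X_i).
by rewrite !zactX [LHS](rmorphM (zact_rmorphism z)) /= -!/(zact z _) zactC zactX mpolyCM; ring.
Qed.

Lemma zactK z g : (forall i, z i != 0) -> zact (fun i => (z i)^-1) (zact z g) = g.
Proof. by move=> z0; rewrite zactM zact1 // => i; rewrite mulVf. Qed.

Lemma zactVK z g : (forall i, z i != 0) -> zact z (zact (fun i => (z i)^-1) g) = g.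
Proof. by move=> z0; rewrite zactM zact1 // => i; rewrite mulfV. Qed.

Lemma meval_zact z w g : (zact z g).@[w] = g.@[fun i => z i * w i].
Proof.
rewrite /zact comp_mpoly_meval; apply: meval_eq => i.
by rewrite tnth_mktuple mevalM mevalC mevalXU.
Qed.

Lemma msize_zact z g : (msize (zact z g) <= msize g)%N.
Proof.
rewrite /zact comp_mpolyEX; apply: leq_trans (msize_sum _ _ _) _.
apply/bigmax_leqP_seq => m mg _; apply: leq_trans (msize_mdeg_lt mg).
apply: leq_trans (msizeZ_le _ _) _; rewrite mdegE comp_mpolyX.
apply: msize_prod_linear => i; rewrite tnth_mktuple mul_mpolyC.
by apply: leq_trans (msizeZ_le _ _) _; rewrite msizeX mdeg1.
Qed.

Lemma vars_in_zact z S g : vars_in S g -> vars_in S (zact z g).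
Proof.
elim=> [c|i iS|f h _ IHf _ IHh|f h _ IHf _ IHh].
- by rewrite zactC; apply: vars_inC.
- by rewrite zactX; apply: vars_inM; [apply: vars_inC | apply: vars_inX].
- by rewrite [zact z _](rmorphD (zact_rmorphism z)); apply: vars_inD.
- by rewrite [zact z _](rmorphM (zact_rmorphism z)); apply: vars_inM.
Qed.

(** The translate of [P] by the inverse of [z]: if [P] vanishes at [w], this ideal vanishes at the
    product of [z] and [w]. *)
Definition translate z P g := P (zact z g).

Lemma translate_prime z P : ring_prime P -> ring_prime (translate z P).
Proof. exact: (ring_prime_preim (zact_rmorphism z)). Qed.

Lemma translate_indep z P S : (forall i, z i != 0) ->
  indep (translate z P) S <-> indep P S.
Proof.
move=> z0; split=> h g vg Pg.
  have e : zact (fun i => (z i)^-1) g = 0.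
    by apply: h; [exact: vars_in_zact | rewrite /translate zactVK].
  by rewrite -(zactVK g z0) e; exact: (rmorph0 (zact_rmorphism z)).
have e : zact z g = 0 by apply: h; [exact: vars_in_zact | exact: Pg].
by rewrite -(zactK g z0) e; exact: (rmorph0 (zact_rmorphism _)).
Qed.

Lemma translate_basis z P S : (forall i, z i != 0) -> transc_basis P S -> transc_basis (translate z P) S.
Proof.
move=> z0 [iS mS]; split; first by apply/translate_indep.
by move=> v vS /translate_indep h; apply: (mS v vS); apply: h.
Qed.

Lemma translate_pdim z P : (forall i, z i != 0) -> pdim (translate z P) = pdim P.
Proof.
move=> z0; apply: eq_bigl => S; congr boolp.asbool; apply: boolp.propext.
exact: translate_indep.
Qed.

Lemma translate_fixes z P : (forall i, z i != 0) ->
  (forall g, P (zact z g) <-> P g) -> fixes_ideal z P.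
Proof.
move=> z0 h g; split=> [[f [Pf ->]]|Pg]; first exact/h.
by exists (zact (fun i => (z i)^-1) g); rewrite zactVK //; split=> //; apply/h; rewrite zactVK.
Qed.

Lemma mideal_ideal : ring_ideal (@mideal k n).
Proof.
split; first by exists (fun=> 0); rewrite big1 // => i _; rewrite mul0r.
split=> [_ _ [c ->] [d ->]|r _ [c ->]].
  by exists (fun i => c i + d i); rewrite -big_split; apply: eq_bigr => i _; rewrite mulrDl.
by exists (fun i => r * c i); rewrite mulr_sumr; apply: eq_bigr => i _; rewrite mulrA.
Qed.

Lemma mideal_meval g : g.@[fun=> 1] = 0 -> @mideal k n g.
Proof.
move=> g1; rewrite -[g]subr0 -(mpolyC0 n k) -g1.
have idm := mideal_ideal.
elim: (vars_in_setT g) => [c|i _|f h _ IHf _ IHh|f h _ IHf _ IHh].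
- by rewrite mevalC subrr; apply: ring_ideal0.
- rewrite mevalXU mpolyC1; exists (fun j => (j == i)%:R).
  by rewrite (bigD1 i) //= eqxx mul1r big1 ?addr0 // => j /negPf ->; rewrite mul0r.
- by rewrite mevalD mpolyCD opprD addrACA; apply: ring_idealD.
- rewrite mevalM mpolyCM.
  have -> : f * h - f.@[fun=> 1]%:MP * h.@[fun=> 1]%:MP =
    f * (h - h.@[fun=> 1]%:MP) + h.@[fun=> 1]%:MP * (f - f.@[fun=> 1]%:MP) by ring.
  by apply: ring_idealD => //; apply: ring_idealMl.
Qed.

End TorusAction.

Section LatticeRank.
Variables (m : nat) (G : ('I_m -> int) -> Prop).

Lemma rank_ge_bound r : rank_ge G r -> (r <= m)%N.
Proof. by case=> v [_ /eqP <-]; apply: rank_leq_col. Qed.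

Lemma rank_exists : exists r, rank_eq G r.
Proof.
apply: NNPP => no.
have h r : rank_ge G r.
  elim: r => [|r IH]; last by apply: NNPP => nr; apply: no; exists r.
  exists (fun=> fun=> 0); split; first by case.
  by rewrite /row_free -leqn0 rank_leq_row.
by have := rank_ge_bound (h m.+1); rewrite ltnn.
Qed.

(** Outside [C] lie [r] columns on which [r] independent elements of [G] form an invertible matrix,
    so these coordinates determine an element of the span. Exponents supported on [C] thus never
    differ by a nonzero element of [G]. *)
Lemma complementary_coordinates r : rank_eq G r ->
  exists C : {set 'I_m}, #|C| = (m - r)%N /\
    forall a, G a -> (forall j, j \notin C -> a j = 0) -> forall j, a j = 0.
Proof.
move=> [[v [Gv freeV]] maxr].
set V := \matrix_(i < r, j < m) ((v i j)%:~R : rat) in freeV.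
have fullV : row_full V^T by rewrite /row_full mxrank_tr; exact: freeV.
pose f := fullrankfun fullV.
exists (~: [set f i | i in 'I_r]); split.
  by rewrite cardsCs setCK card_imset ?card_ord //; exact: fullrankfun_inj.
move=> a Ga a0.
pose u : 'rV[rat]_m := \row_j (a j)%:~R.
(* Were [a] outside the span, adjoining it would give [r.+1] independent elements of [G]. *)
have /submxP [w ew] : (u <= V)%MS.
  apply: contraT => nuV; case: maxr.
  exists (fun i => oapp v a (unlift ord0 i)); split.
    by move=> i; case: (unlift ord0 i) => [j|] /=; [exact: Gv | exact: Ga].
  have -> : \matrix_(i < r.+1, j < m) ((oapp v a (unlift ord0 i) j)%:~R : rat) = col_mx u V.
    apply/matrixP => i j; rewrite !mxE; case: splitP => i' ei.
      have -> : i = ord0 by apply: val_inj; rewrite /= ei ord1.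
      by rewrite unlift_none !mxE.
    have -> : i = lift ord0 i' by apply: val_inj; rewrite /= ei.
    by rewrite liftK !mxE.
  have lt : (V < u + V)%MS by rewrite /ltmx addsmxSr addsmx_sub (negPf nuV).
  have : (r < \rank (col_mx u V))%N.
    by rewrite -addsmxE; move: lt; rewrite ltmxErank => /andP [_]; rewrite (eqP freeV).
  by rewrite /row_free eqn_leq rank_leq_row.
have w0 : w = 0.
  have unitf : (rowsub f V^T)^T \in unitmx by rewrite unitmx_tr; exact: fullrowsub_unit.
  rewrite -(mulmxK unitf w) (_ : w *m _ = 0) ?mul0mx //.
  apply/rowP => i; rewrite [RHS]mxE.
  have : u 0 (f i) = 0 by rewrite mxE a0 //; rewrite inE negbK imset_f.
  rewrite ew !mxE => e; rewrite -[RHS]e; apply: eq_bigr => j _; congr (_ * _).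
  by rewrite !mxE.
move=> j; have : u 0 j = 0 by rewrite ew w0 mul0mx mxE.
by rewrite mxE => /eqP; rewrite intr_eq0 => /eqP.
Qed.

End LatticeRank.

(** * The induction on heights *)

Section Translates.
Variables (k : fieldType) (hk : [pchar k] =i pred0) (n m : nat).
Variables (x : 'I_m -> 'I_n -> k) (hx : forall i j, x i j != 0).
Local Notation R := {mpoly k[n]}.
Implicit Types (P : R -> Prop) (a b : 'I_m -> nat).

Lemma xpow_neq0 a j : xpow x a j != 0.
Proof. by apply/prodf_neq0 => i _; rewrite expf_neq0. Qed.

Lemma xpowD a b j : xpow x (fun i => (a i + b i)%N) j = xpow x a j * xpow x b j.
Proof. by rewrite /xpow -big_split; apply: eq_bigr => i _; rewrite exprD. Qed.

Lemma xpow0 j : xpow x (fun=> 0%N) j = 1.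
Proof. by rewrite /xpow big1 // => i _; rewrite expr0. Qed.

Lemma xpowzB a b j :
  xpowz x (fun i => (a i)%:Z - (b i)%:Z) j = xpow x a j * (xpow x b j)^-1.
Proof.
rewrite /xpowz /xpow -prodfV -big_split; apply: eq_bigr => i _ /=.
by rewrite expfzDr // -exprnN.
Qed.

(** The torus is commutative, so equality of two translates of [P] is a stabilizer condition on any
    further translate, in particular on the one that moves [x^b] to the point 1. *)
Lemma translates_distinct P b a a' :
    (forall g, translate (xpow x a) P g <-> translate (xpow x a') P g) ->
  stab x (translate (fun j => (xpow x b j)^-1) P) (fun i => (a i)%:Z - (a' i)%:Z).
Proof.
move=> h; apply: translate_fixes.
  by move=> j; rewrite xpowzB mulf_neq0 ?invr_eq0 ?xpow_neq0.
move=> g; have := h (zact (fun j => (xpow x b j)^-1 * (xpow x a' j)^-1) g).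
rewrite /translate !zactM.
have -> : zact (fun j => (xpow x b j)^-1 * xpowz x (fun i => (a i)%:Z - (a' i)%:Z) j) g =
    zact (fun j => xpow x a j * ((xpow x b j)^-1 * (xpow x a' j)^-1)) g.
  by apply: zact_eq => j; rewrite xpowzB; ring.
have -> : zact (fun j => xpow x a' j * ((xpow x b j)^-1 * (xpow x a' j)^-1)) g =
    zact (fun j => (xpow x b j)^-1) g.
  by apply: zact_eq => j; rewrite mulrCA mulfV ?xpow_neq0 // mulr1.
by [].
Qed.

Variable mp : nat -> nat.
Hypothesis hmp : forall r, (1 <= r <= n)%N -> is_max_stab_rank x r (mp r).
Variables (f : R) (hf : f != 0).
Let D := (msize f).-1.
Hypothesis D0 : (0 < D)%N.
Variable T : nat -> nat.
Hypothesis hT : forall r, (1 <= r <= n)%N -> (D ^ r < (T r).+1 ^ (m - mp r))%N.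

Definition bound r := (\sum_(1 <= j < r) T j)%N.

Lemma boundS r : (1 <= r)%N -> bound r.+1 = (bound r + T r)%N.
Proof. by move=> r1; rewrite /bound big_nat_recr. Qed.

Lemma bound_mono r s : (r <= s)%N -> (bound r <= bound s)%N.
Proof.
move=> /subnK <-; elim: (s - r)%N => [|l IH] //; rewrite addSn.
case: (l + r)%N IH => [|u] IH; first by rewrite (leq_trans IH) // /bound !big_geq.
by rewrite boundS // (leq_trans IH) // leq_addr.
Qed.

Definition orbit_gens r (g : R) :=
  exists a, (forall i, (a i <= bound r)%N) /\ g = zact (xpow x a) f.

(** [pdim P + r <= n] says that [P] has height at least [r]. As [bound r] is T_1 + ... + T_(r-1),
    the exponents [b] may use T_r + ... + T_n. *)
Definition codim_claim r := forall P, ring_prime P ->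
  (forall g, orbit_gens r g -> P g) ->
  forall b, (forall i, (b i <= bound n.+1 - bound r)%N) ->
  (forall g, P g -> g.@[xpow x b] = 0) -> (pdim P + r <= n)%N.

Lemma codim_claim1 : codim_claim 1.
Proof.
move=> P hP gP b _ _; rewrite addn1 ltn_neqAle pdim_le andbT.
apply/eqP => e; move/eqP: hf; apply.
have [S [[iS _] eS]] := pdim_basis hP.
have ST : S = setT by apply/eqP; rewrite eqEcard subsetT eS e cardsT card_ord leqnn.
apply: iS; first by rewrite ST; apply: vars_in_setT.
apply: gP; exists (fun=> 0%N); split=> //.
by rewrite zact1 // => j; apply: xpow0.
Qed.

Lemma codim_step r : (1 <= r <= n)%N -> codim_claim r -> codim_claim r.+1.
Proof.
move=> rn IH P hP gP b hb vanP; have [r1 rn'] := andP rn.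
have bS := boundS r1.
have bn : (bound r.+1 <= bound n.+1)%N by apply: bound_mono.
have gens_incl g : orbit_gens r g -> P g.
  move=> [a [ha ->]]; apply: gP; exists a; split=> // i.
  by apply: leq_trans (ha i) _; rewrite bS leq_addr.
have hle : (pdim P + r <= n)%N.
  by apply: (IH P hP gens_incl b) => // i; have := hb i; lia.
(* If the height is exactly [r], moving [x^b] to 1 gives a prime inside [mideal], to which the bound
   on stabilizer ranks applies. *)
rewrite addnS ltn_neqAle hle andbT; apply/eqP => eP.
pose y j := (xpow x b j)^-1.
have y0 j : y j != 0 by rewrite invr_eq0 xpow_neq0.
pose P0 := translate y P.
have hP0 : ring_prime P0 by apply: translate_prime.
have P0m : psubset P0 (@mideal k n).
  move=> g /vanP; rewrite meval_zact => e; apply: mideal_meval.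
  by rewrite -[RHS]e; apply: meval_eq => j; rewrite mulVf ?xpow_neq0.
have P0h : height_eq P0 r.
  have -> : r = (n - pdim P0)%N by rewrite translate_pdim //; lia.
  exact: height_pdim.
have [rho hrho] := rank_exists (stab x P0).
have rho_mp : (rho <= mp r)%N by have [_ hmax] := hmp rn; apply: hmax P0h hrho.
have [C [cardC hC]] := complementary_coordinates hrho.
(* Exponents supported on [C] with entries at most [T r]; there are (T_r + 1)^(m - rho) of them,
   more than D^r by [hT]. *)
pose I := {ffun {j : 'I_m | j \in C} -> 'I_(T r).+1}.
pose e (s : I) (i : 'I_m) : nat := if insub i is Some j then s j else 0%N.
have eT s i : (e s i <= T r)%N.
  by rewrite /e; case: insub => [j|] //; rewrite -ltnS ltn_ord.
have [S [bS' cS]] := pdim_basis hP.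
pose q (s : I) := translate (xpow x (e s)) P.
have hq s : ring_prime (q s) by apply: translate_prime.
have dq s : pdim (q s) = pdim P by apply: translate_pdim => j; apply: xpow_neq0.
have qvan s g : q s g -> g.@[xpow x (fun i => (e s i + b i)%N)] = 0.
  move=> /vanP; rewrite meval_zact => <-.
  by apply: meval_eq => j; rewrite xpowD.
have er : (n - #|S| = r)%N by rewrite cS; lia.
suff : (#|I| <= D ^ (n - #|S|))%N.
  rewrite er leqNgt => /negP; apply; apply: leq_trans (hT rn) _.
  rewrite card_ffun card_ord card_sig leq_pexp2l //.
  by rewrite (eq_card (_ : _ =i C)) ?cardC //; lia.
apply: (@bezout_basis k n I q (orbit_gens r) D S) => //.
- by move=> s; apply: translate_basis => // j; apply: xpow_neq0.
- move=> g [a [_ ->]]; apply: leq_trans (msize_zact _ _) _.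
  by rewrite /D; case: (msize f).
(* Adding [e s] raises exponents by at most [T r], and [P] contains the generators for [r.+1]; so
   [q s] contains those for [r]. *)
- move=> s g [a [ha ->]]; rewrite /q /translate zactM; apply: gP.
  exists (fun i => (e s i + a i)%N); split.
    by move=> i; rewrite bS addnC leq_add.
  by apply: zact_eq => j; rewrite xpowD.
- move=> s s' ss'; apply: NNPP => no; move/eqP: ss'; apply.
  have sub g : q s g -> q s' g.
    by move=> qg; apply: NNPP => nq; apply: no; exists g.
  (* All translates have the same [pdim], so an inclusion between two of them is an equality. *)
  have sup g : q s' g -> q s g.
    move=> qg; apply: NNPP => nq.
    have := pdim_strict (hq s) (hq s') sub (ex_intro _ g (conj qg nq)).
    by rewrite !dq ltnn.
  have := @translates_distinct P b (e s) (e s') (fun g => conj (@sub g) (@sup g)).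
  move=> /hC h; apply/ffunP => -[j jC]; apply: val_inj.
  have : (e s j)%:Z - (e s' j)%:Z = 0.
    apply: h => i iC; rewrite /e; case: insubP => [u|_]; last by rewrite subrr.
    by rewrite (negPf iC).
  move=> /eqP; rewrite subr_eq0 => /eqP [].
  by rewrite /e insubT.
(* A prime over the generators and strictly below [q s] would have height less than [r], against the
   induction hypothesis at the point with exponents [e s + b]. *)
- move=> s g qg; apply: local_nilpotent (hq s) _ => P' hP' gP' P'q.
  apply: NNPP => nP'g.
  have lt := pdim_strict hP' (hq s) P'q (ex_intro _ g (conj qg nP'g)).
  have : (pdim P' + r <= n)%N.
    apply: (IH P' hP' gP' (fun i => (e s i + b i)%N)).
      by move=> i; have := eT s i; have := hb i; lia.
    by move=> h /P'q /qvan.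
  by move: lt; rewrite dq; lia.
Qed.

(** Otherwise the ideal of the point 1 would contain all generators for [n.+1], hence have height at
    least n + 1. *)
Lemma nonvanishing_translate :
  exists a, (forall i, (a i <= bound n.+1)%N) /\ f.@[xpow x a] != 0.
Proof.
apply: NNPP => no.
have claim r : (1 <= r <= n.+1)%N -> codim_claim r.
  elim: r => // -[|r] IH rn; first exact: codim_claim1.
  by apply: codim_step; [lia | apply: IH; lia].
pose P (g : R) := g.@[fun=> 1] = 0.
have hP : ring_prime P.
  apply: (@ring_prime_preim _ _ (GRing.RMorphism.clone _ _ (meval (fun=> 1 : k)) _)
            (fun c => c = 0)).
  split.
  - split=> //; split=> [a b -> ->|c a ->]; by rewrite ?addr0 ?mulr0.
  - by apply/eqP; rewrite oner_eq0.
  - by move=> a b /eqP; rewrite mulf_eq0 => /orP [] /eqP; [left | right].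
have : (pdim P + n.+1 <= n)%N.
  apply: (claim n.+1 _ P hP _ (fun=> 0%N)) => //; first by rewrite leqnn.
    move=> g [a [ha ->]]; rewrite /P meval_zact.
    apply: NNPP => nz; apply: no; exists a; split=> //; apply/eqP => e; apply: nz.
    by rewrite -[RHS]e; apply: meval_eq => j; rewrite mulr1.
  by move=> g Pg; rewrite -[RHS]Pg; apply: meval_eq => j; apply: xpow0.
by rewrite addnS ltnNge leq_addl.
Qed.

End Translates.

(** * Integer parts of real powers *)

Section RealBound.
Local Open Scope R_scope.

Lemma INR_expn (d r : nat) : INR (d ^ r)%N = INR d ^ r.
Proof. by elim: r => [|r IH] //; rewrite expnS -multE mult_INR IH. Qed.

Lemma pow_lt_pow (a b : R) (l : nat) : 0 <= a -> a < b -> (0 < l)%N -> a ^ l < b ^ l.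
Proof.
move=> a0 ab; case: l => // l _; elim: l => [|l IH]; first by rewrite /=; lra.
change (a * a ^ l.+1 < b * b ^ l.+1); apply: Rmult_le_0_lt_compat => //.
exact: pow_le.
Qed.

Definition nat_floor (y : R) := Z.to_nat (Int_part y).

Lemma nat_floorP (y : R) : 0 <= y -> INR (nat_floor y) <= y < INR (nat_floor y).+1.
Proof.
move=> y0; have [h1 h2] := base_Int_part y.
have z0 : Z.le Z0 (Int_part y).
  by apply/Z.lt_succ_r; apply: lt_IZR; rewrite succ_IZR; lra.
rewrite S_INR /nat_floor INR_IZR_INZ Z2Nat.id //; lra.
Qed.

(** For y = d^(r/l), the integer part plus 1 exceeds y, and y^l = d^r. *)
Lemma npow_floor_bound (d r l : nat) : (0 < d)%N -> (0 < l)%N ->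
  (d ^ r < (nat_floor (npow d (INR r / INR l))).+1 ^ l)%N.
Proof.
move=> d0 l0; have d0' : 0 < INR d by apply: lt_0_INR; apply/ssrnat.ltP.
have l0' : 0 < INR l by apply: lt_0_INR; apply/ssrnat.ltP.
have -> : npow d (INR r / INR l) = Rpower (INR d) (INR r / INR l) by case: (d) d0.
set y := Rpower _ _.
have y0 : 0 < y by apply: exp_pos.
have [_ h] := nat_floorP (Rlt_le _ _ y0).
apply/ssrnat.ltP/INR_lt; rewrite !INR_expn.
have -> : INR d ^ r = y ^ l.
  rewrite -!Rpower_pow // /y Rpower_mult; congr Rpower.
  by rewrite /Rdiv Rmult_assoc Rinv_l ?Rmult_1_r //; lra.
by apply: pow_lt_pow => //; lra.
Qed.

Lemma sum_floor_le (g : nat -> R) (l : nat) : (forall i, 0 <= g i) ->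
  INR (\sum_(1 <= j < l.+1) nat_floor (g j))%N <= Rsum_1 g l.
Proof.
move=> g0; elim: l => [|l IH]; first by rewrite big_geq //=; lra.
rewrite big_nat_recr //=; rewrite plus_INR.
by have [h _] := nat_floorP (g0 l.+1); apply: Rplus_le_compat.
Qed.

Lemma npow_ge0 d y : 0 <= npow d y.
Proof. by case: d => [|d] /=; [lra | apply/Rlt_le/exp_pos]. Qed.

End RealBound.

Theorem theorem5p11 (k : fieldType) (hk : [pchar k] =i pred0) (n m : nat)
  (x : 'I_m -> 'I_n -> k) (hx : forall i j, x i j != 0)
  (mp : nat -> nat)
  (hmp : forall n', (1 <= n' <= n)%N -> is_max_stab_rank x n' (mp n'))
  (hlt : forall n', (1 <= n' <= n)%N -> (mp n' < m)%N)
  (f : {mpoly k[n]}) (hf : f != 0) :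
  exists a : 'I_m -> nat,
    (forall i, Rle (INR (a i)) (Xbound n m mp (msize f).-1)) /\
    f.@[xpow x a] != 0.
Proof.
pose g r := npow (msize f).-1 (Rdiv (INR r) (INR (m - mp r))).
have g0 i : Rle 0 (g i) by apply: npow_ge0.
(* The Bezout bound requires D > 0; for D = 0 the polynomial is a nonzero constant and the zero
   exponents do. *)
have [D0|D0] := posnP (msize f).-1.
  exists (fun=> 0%N); split.
    move=> i; apply: Rle_trans (sum_floor_le n g0); exact: pos_INR.
  have fC : f = (f@_0)%:MP by apply: msize1_polyC; move: D0; lia.
  by rewrite fC mevalC; apply: contra hf => /eqP c0; rewrite fC c0 mpolyC0.
have [|a [ha fa]] := @nonvanishing_translate k hk n m x hx mp hmp f hf D0
    (fun r => nat_floor (g r)).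
  move=> r rn; apply: npow_floor_bound => //.
  by rewrite subn_gt0; apply: hlt.
exists a; split=> // i.
by apply: Rle_trans (sum_floor_le n g0); apply/le_INR/ssrnat.leP; apply: ha.
Qed.
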